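(* There is a minimal distal dynamical system $(X,s)$ such that $(E(X,s),\lambda_s)$ has quasi-discrete spectrum but $(X,s)$ does not have quasi-discrete spectrum.
   Context: A dynamical system is a pair $(X,s)$ with $X$ a compact Hausdorff space and $s:X\to X$ a homeomorphism; it is minimal if every orbit $\{s^nx:n\in\mathbb{Z}\}$ is dense. The enveloping semigroup $E(X,s)$ is the closure of $\{s^n:n\in\mathbb{Z}\}$ in the product space $X^X$; $(X,s)$ is distal if every member of $E(X,s)$ is injective. $(E(X,s),\lambda_s)$ is the dynamical system with $\lambda_s(a)=s\circ a$. $\mathbb{T}$ is the unit circle in $\mathbb{C}$; $\mathcal{C}(X)$ is the algebra of continuous complex functions on $X$ (supremum norm); $\mathcal{C}(X,\mathbb{T})$ the multiplicative group of continuous functions $X\to\mathbb{T}$; $s^*f=f\circ s$. Let $G_0(X,s)$ be the constant functions $X\to\mathbb{T}$, $G_{m+1}(X,s)=\{g\in\mathcal{C}(X,\mathbb{T}): s^*g=fg\text{ for some }f\in G_m(X,s)\}$, $G(X,s)=\bigcup_{m\ge0}G_m(X,s)$. $(X,s)$ has (topological) quasi-discrete spectrum if the linear span of $G(X,s)$ is dense in $\mathcal{C}(X)$. *)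

(* Defs.v *)
From HB Require Import structures.
From mathcomp Require Import all_boot all_order all_algebra complex.
From mathcomp Require Import all_classical all_reals all_analysis.

Set Implicit Arguments.
Unset Strict Implicit.
Unset Printing Implicit Defensive.

Import Order.TTheory GRing.Theory Num.Theory.
Import numFieldNormedType.Exports.

Local Open Scope classical_set_scope.
Local Open Scope ring_scope.

(* The homeomorphism is recorded together with its inverse, so that its
   negative powers are available; the inverse is determined by the map. *)
Record dynSys := DynSys {
  space :> topologicalType;
  shift : space -> space;
  shiftV : space -> space;
  shiftK : cancel shift shiftV;
  shiftVK : cancel shiftV shift;
  shift_continuous : continuous shift;
  shiftV_continuous : continuous shiftV;
  space_compact : compact [set: space];
  space_hausdorff : hausdorff_space space }.

Section Dynamics.
Variable X : dynSys.

Definition shiftz (n : int) : X -> X :=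
  match n with
  | Posz k => iter k (@shift X)
  | Negz k => iter k.+1 (@shiftV X)
  end.

Definition orbitz (x : X) : set X := range (fun n => shiftz n x).

Definition minimal_sys : Prop := forall x : X, dense (orbitz x).

Definition ellis : set {ptws X -> X} :=
  closure (range shiftz : set {ptws X -> X}).

Definition distal_sys : Prop :=
  forall a : X -> X, ellis a -> injective a.

Lemma comp_ptws_continuous (h : X -> X) : continuous h ->
  continuous ((fun a => h \o a) : {ptws X -> X} -> {ptws X -> X}).
Proof.
move=> hc a; apply/cvg_sup.
  exact: (fmap_filter _ (@nbhs_filter {ptws X -> X} a)).
move=> x; move: a.
apply: (@continuous_comp_initial _ {ptws X -> X} X (fun f : X -> X => f x)) => a.
apply: (@continuous_comp {ptws X -> X} X X (fun f => f x) h); last exact: hc.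
exact: (@proj_continuous X (fun=> X) x a).
Qed.

Lemma shift_shiftz n : exists m, @shift X \o shiftz n = shiftz m.
Proof.
case: n => [k|k]; first by exists (Posz k.+1).
case: k => [|k]; first by exists 0; apply/funext => x /=; rewrite shiftVK.
by exists (Negz k); apply/funext => x /=; rewrite shiftVK.
Qed.

Lemma shiftV_shiftz n : exists m, @shiftV X \o shiftz n = shiftz m.
Proof.
case: n => [[|k]|k]; first by exists (Negz 0).
  by exists (Posz k); apply/funext => x /=; rewrite shiftK.
by exists (Negz k.+1).
Qed.

Lemma ellis_comp (h : X -> X) : continuous h ->
  (forall n, exists m, h \o shiftz n = shiftz m) ->
  forall a, ellis a -> ellis (h \o a).
Proof.
move=> hc hz a Ea B nB.
have [_ [[n _ <-] Bn]] := Ea _ (comp_ptws_continuous hc nB).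
by have [m hm] := hz n; exists (h \o shiftz n); split => //; exists m.
Qed.

Definition ellis_act (h : X -> X)
    (hE : forall a, ellis a -> ellis (h \o a)) (a : ellis) : ellis :=
  SigSub (mem_set (hE _ (set_mem (valP a)))).

Lemma ellis_act_continuous h hE : continuous h -> continuous (@ellis_act h hE).
Proof.
move=> hc; apply: continuous_comp_initial => a.
apply: (@continuous_comp ellis {ptws X -> X} {ptws X -> X} set_val
  (fun b => h \o b)).
  exact: (@initial_continuous ellis {ptws X -> X} set_val a).
exact: comp_ptws_continuous.
Qed.

Definition ellis_shift : ellis -> ellis :=
  ellis_act (ellis_comp (@shift_continuous X) shift_shiftz).

Definition ellis_shiftV : ellis -> ellis :=
  ellis_act (ellis_comp (@shiftV_continuous X) shiftV_shiftz).

Lemma ellis_shiftK : cancel ellis_shift ellis_shiftV.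
Proof. by move=> a; apply/val_inj/funext => x /=; rewrite shiftK. Qed.

Lemma ellis_shiftVK : cancel ellis_shiftV ellis_shift.
Proof. by move=> a; apply/val_inj/funext => x /=; rewrite shiftVK. Qed.

Lemma ellis_compact : compact [set: ellis].
Proof.
have Ec : compact ellis.
  apply: (@subclosed_compact {ptws X -> X} _ setT) => //.
    exact: closed_closure.
  have := @tychonoff X (fun=> X) (fun=> setT) (fun=> @space_compact X).
  by congr compact; apply/seteqP; split.
move=> F PF _.
have EF : F (set_val @^-1` ellis).
  by apply: (@filterS _ F _ setT) (@filterT _ F _) => -[a Ea] _; exact: set_mem.
have [p [Ep clp]] := Ec _ (fmap_proper_filter set_val PF) EF.
exists (SigSub (mem_set Ep)); split => // A B FA nB.
have [C [oC Cp] CB] : exists2 C : set {ptws X -> X},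
    open_nbhs p C & set_val @^-1` C `<=` B.
  move: nB; rewrite nbhsE => -[_ [[C oC <-] Cp] CB].
  by exists C.
have [||_ [[a Aa <-] Ca]] := clp (set_val @` A) C.
- by apply: (@filterS _ F _ A) FA => a Aa; exists a.
- exact: open_nbhs_nbhs.
by exists a; split => //; exact: CB.
Qed.

Lemma ellis_hausdorff : hausdorff_space ellis.
Proof.
move=> a b ab; apply/val_inj.
apply: (@hausdorff_product X (fun=> X) (fun=> @space_hausdorff X)) => A B nA nB.
have [||c [Ac Bc]] := ab (set_val @^-1` A) (set_val @^-1` B).
- exact: (@initial_continuous ellis {ptws X -> X} set_val a).
- exact: (@initial_continuous ellis {ptws X -> X} set_val b).
by exists (set_val c).
Qed.

Definition enveloping : dynSys :=
  DynSys ellis_shiftK ellis_shiftVK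
    (ellis_act_continuous (@shift_continuous X))
    (ellis_act_continuous (@shiftV_continuous X))
    ellis_compact ellis_hausdorff.

End Dynamics.

Section QuasiDiscreteSpectrum.
Variable R : realType.

(* Typing R[i] as a numClosedFieldType is what gives access to its norm
   topology. *)
Definition C : numClosedFieldType := R[i]%C.

Definition lin_span (X : Type) (A : set (X -> C)) : set (X -> C) :=
  [set f | exists n (c : 'I_n -> C) (g : 'I_n -> X -> C),
     (forall k, A (g k)) /\ f = (fun x => \sum_(k < n) c k * g k x)].

Definition circle_valued (X : topologicalType) : set (X -> C) :=
  [set g | continuous g /\ forall x, `|g x| = 1].

Variable X : dynSys.

Fixpoint quasi_eigen (m : nat) : set (X -> C) :=
  match m with
  | 0 => [set g | exists2 c : C, `|c| = 1 & g = (fun=> c)]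
  | k.+1 => [set g | @circle_valued X g /\
      exists2 f, quasi_eigen k f & g \o @shift X = (fun x => f x * g x)]
  end.

Definition quasi_eigenfunctions : set (X -> C) := \bigcup_m quasi_eigen m.

(* The topology of {uniform X -> C} induces on the continuous functions the one
   of the supremum norm; the members of quasi_eigenfunctions are continuous. *)
Definition quasi_discrete_spectrum : Prop :=
  [set f : X -> C | continuous f] `<=`
  closure (lin_span quasi_eigenfunctions : set {uniform X -> C}).

End QuasiDiscreteSpectrum.

(* Main.v *)
Require Import Defs.
From HB Require Import structures.
From mathcomp Require Import all_boot all_order all_algebra complex.
From mathcomp Require Import all_classical all_reals all_analysis.
From mathcomp Require Import ring lra zify.

(* The example is the skew product on {0,1} x T x T
     s(0,z,w) = (1, beta z, z w),   s(1,z,w) = (0, beta z, w),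
   with beta not a root of unity. It is a factor of an affine system, but the
   two components are glued so that the quasi-eigenfunctions of X cannot
   distinguish (j,z,w) from (j,z,-w): if g(j,z,tw) = c(t) g(j,z,w), then the
   quotient of g o s by g is again a quasi-eigenfunction, it does not depend on
   w, and moving z by t multiplies it by the same constant on both components;
   with F(z) = g(1,z,1) / g(0,z,1) this makes c(z) F(z) F(beta z) constant, and
   comparing z with -z gives c(-1) = 1.

   Along an orbit of the component 0 the fibre coordinate has the phases
   z^ceil(n/2) and beta^(k(k-1)), n = 2k, or beta^(k(k+1)), n = 2k+1. On E(X)
   the quotients of the fibre coordinates of different points, corrected by a
   constant depending on the parity of n, are the eigenfunctions n |-> r^n, for
   every r in T; with their help the quadratic phase becomes n^2/4, so that the
   quasi-eigenfunctions of E(X) separate points and Stone-Weierstrass applies.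

   Minimality follows Furstenberg: in a minimal subset the fibres are cosets of
   a closed subgroup of T, and a finite subgroup is impossible. *)

Set Implicit Arguments.
Unset Strict Implicit.
Unset Printing Implicit Defensive.

Import Order.TTheory GRing.Theory Num.Theory.
Import numFieldNormedType.Exports.
(* [shift] is also a constant of MathComp-Analysis. *)
Import Defs.

Local Open Scope classical_set_scope.
Local Open Scope ring_scope.

(** * The circle group *)

Section Circle.
Variable R : realType.
Local Notation C := (C R).

Lemma real_complex_continuous : continuous (fun x : R => (x%:C)%C : C).
Proof.
move=> x; apply/cvgrPdist_lt => e e0.
have eR : e = ((complex.Re e)%:C)%C by rewrite RRe_real // gtr0_real.
have e0' : 0 < complex.Re e by rewrite -ltcR -eR.
near=> y.
have -> : ((x%:C)%C - (y%:C)%C : C) = ((x - y)%:C)%C by rewrite rmorphB.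
rewrite normc_def /= expr0n /= addr0 sqrtr_sqr eR ltcR.
by near: y; apply: (@nbhsx_ballx R R x _ e0').
Unshelve. all: by end_near. Qed.

Lemma Re_continuous : continuous (fun z : C => complex.Re z : R).
Proof.
move=> x.
apply: (iffRL (@cvgrPdist_lt R R^o C (nbhs x) (nbhs_filter x) _ _)) => e e0.
have e0' : 0 < ((e%:C)%C : C) by rewrite ltcR.
near=> y.
have : `|x - y| < (e%:C)%C by near: y; apply: (@nbhsx_ballx C C x _ e0').
rewrite -ltcR; apply: le_lt_trans.
by have := normc_ge_Re (x - y); case: (x) (y) => [? ?] [? ?].
Unshelve. all: by end_near. Qed.

Lemma mul_continuous_fun (T : topologicalType) (f g : T -> C) :
  continuous f -> continuous g -> continuous (fun x => f x * g x).
Proof. by move=> cf cg x; apply: cvgM; [exact: cf|exact: cg]. Qed.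

Lemma add_continuous_fun (T : topologicalType) (f g : T -> C) :
  continuous f -> continuous g -> continuous (fun x => f x + g x).
Proof. by move=> cf cg x; apply: cvgD; [exact: cf|exact: cg]. Qed.

Lemma sub_continuous_fun (T : topologicalType) (f g : T -> C) :
  continuous f -> continuous g -> continuous (fun x => f x - g x).
Proof. by move=> cf cg x; apply: cvgB; [exact: cf|exact: cg]. Qed.

Lemma exp_continuous_fun (T : topologicalType) (f : T -> C) n :
  continuous f -> continuous (fun x => f x ^+ n).
Proof.
move=> cf; elim: n => [|n IH].
  rewrite (_ : (fun _ => _) = (fun=> 1)); first by move=> x; exact: cvg_cst.
  by apply/funext => x; rewrite expr0.
rewrite (_ : (fun _ => _) = (fun x => f x * f x ^+ n)).
  exact: mul_continuous_fun cf IH.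
by apply/funext => x; rewrite exprS.
Qed.

Lemma inv_continuous_fun (T : topologicalType) (f : T -> C) :
  continuous f -> (forall x, f x != 0) -> continuous (fun x => (f x)^-1).
Proof. by move=> cf f0 x; apply: cvgV; [exact: f0|exact: cf]. Qed.

Lemma cst_continuous_fun (T : topologicalType) (c : C) :
  continuous (fun _ : T => c).
Proof. by move=> x; exact: cvg_cst. Qed.

Definition circle : set C := [set z | `|z| = 1].

Definition mkcircle (z : C) (h : `|z| = 1) : circle := SigSub (mem_set h).

Lemma norm_val (z : circle) : `|val z| = 1.
Proof. exact: set_mem (valP z). Qed.

Lemma val_neq0 (z : circle) : val z != 0.
Proof. by rewrite -normr_eq0 norm_val oner_eq0. Qed.

Lemma circleM_subproof (z w : circle) : `|val z * val w| = 1.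
Proof. by rewrite normrM !norm_val mulr1. Qed.

Lemma circleV_subproof (z : circle) : `|(val z)^-1| = 1.
Proof. by rewrite normfV norm_val invr1. Qed.

Definition circle1 : circle := mkcircle (@normr1 C).
Definition circleM (z w : circle) : circle := mkcircle (circleM_subproof z w).
Definition circleV (z : circle) : circle := mkcircle (circleV_subproof z).

Lemma val_continuous : continuous (val : circle -> C).
Proof. by move=> x; exact: (@initial_continuous circle C set_val x). Qed.

Lemma to_circle_continuous (T : topologicalType) (f : T -> circle) :
  continuous (val \o f) -> continuous f.
Proof. exact: continuous_comp_initial. Qed.

Lemma circle_exp_subproof (t : R) : `|((cos t)%:C)%C + 'i%C * ((sin t)%:C)%C :
  C| = 1.
Proof.
rewrite normc_def /= !mul0r !mul1r !add0r !subr0 ?addr0.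
by rewrite cos2Dsin2 sqrtr1.
Qed.

Definition circle_exp (t : R) : circle := mkcircle (circle_exp_subproof t).

Lemma circle_exp_continuous : continuous circle_exp.
Proof.
apply: to_circle_continuous => t.
apply: cvgD.
  by apply: (continuous_comp (@continuous_cos R t));
    exact: real_complex_continuous.
apply: cvgM; first exact: cvg_cst.
by apply: (continuous_comp (@continuous_sin R t));
  exact: real_complex_continuous.
Qed.

Lemma circle_expE t : val (circle_exp t) = (Complex (cos t) (sin t)).
Proof. by rewrite /=; simpc. Qed.

Lemma circle_expD s t : circle_exp (s + t) = circleM (circle_exp s) (circle_exp
  t).
Proof.
by apply: val_inj; rewrite [RHS]/= !circle_expE cosD sinD; simpc; congr Complex;
  ring.
Qed.

Lemma circle_exp0 : circle_exp 0 = circle1.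
Proof. by apply: val_inj; rewrite circle_expE cos0 sin0. Qed.

Lemma circle_exp_surj (z : circle) :
  exists2 t, - pi <= t <= pi & circle_exp t = z.
Proof.
have := norm_val z; case E : (val z) => [x y]; rewrite normc_def /=.
move=> /complexI/(congr1 (fun x => x ^+ 2)); rewrite expr1n sqr_sqrtr;
  last first.
  by rewrite addr_ge0 ?sqr_ge0.
move=> xy1.
have x1 : -1 <= x <= 1.
  by apply/andP; split; nra.
have [y0|y0] := leP 0 y.
  exists (acos x).
    by rewrite acos_lepi // andbT (le_trans _ (acos_ge0 _)) // oppr_le0 pi_ge0.
  apply: val_inj; rewrite E circle_expE acosK // sin_acos //.
  by congr Complex; rewrite -xy1 addrC addKr sqrtr_sqr ger0_norm.
exists (- acos x).
  rewrite lerN2 acos_lepi //= (le_trans _ (pi_ge0 _)) //.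
  by rewrite oppr_le0 acos_ge0.
apply: val_inj; rewrite E circle_expE cosN sinN acosK // sin_acos //.
by congr Complex; rewrite -xy1 addrC addKr sqrtr_sqr ltr0_norm // opprK.
Qed.

Lemma circle_compact : compact [set: circle].
Proof.
have <- : circle_exp @` `[- pi, pi] = [set: circle].
  apply/seteqP; split => // z _; have [t tpi <-] := circle_exp_surj z.
  by exists t => //=; rewrite in_itv.
apply: continuous_compact; last exact: segment_compact.
by apply: continuous_subspaceT; exact: circle_exp_continuous.
Qed.

Lemma circle_hausdorff : hausdorff_space circle.
Proof.
move=> a b ab; apply/val_inj; apply: (@norm_hausdorff _ C) => A B nA nB.
have [||c [Ac Bc]] := ab (val @^-1` A) (val @^-1` B).
- exact: val_continuous.
- exact: val_continuous.
by exists (val c).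
Qed.

Lemma circle_exp2pi : circle_exp (pi *+ 2) = circle1.
Proof. by apply: val_inj; rewrite circle_expE cos2pi sin2pi. Qed.

Lemma circle_expMn t n : val (circle_exp (t *+ n)) = val (circle_exp t) ^+ n.
Proof.
elim: n => [|n IH]; first by rewrite mulr0n circle_exp0 expr0.
by rewrite mulrS exprS -IH circle_expD.
Qed.

Lemma circle_exp_div t n : val (circle_exp (t / n.+1%:R)) ^+ n.+1 = val
  (circle_exp t).
Proof. by rewrite -circle_expMn -(mulr_natr (t / _)) divfK // pnatr_eq0. Qed.

Lemma circle_root (z : circle) n : exists r : circle, val r ^+ n.+1 = val z.
Proof. by have [t _ <-] := circle_exp_surj z; exists (circle_exp (t / n.+1%:R));
  exact: circle_exp_div. Qed.

(** The roots [circle_exp (t / n.+1%:R)] of [circle_exp t] tend to 1 as [n] grows. Hence a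
    multiplicative property known only near 1 reaches every point of the circle. *)
Lemma circle_root_near (P : set circle) (z : circle) : nbhs circle1 P ->
  exists2 r, P r & exists n, val r ^+ n = val z.
Proof.
have [t _ <-] := circle_exp_surj z; rewrite -circle_exp0 => nP.
have : nbhs (0 : R) (circle_exp @^-1` P) by exact: circle_exp_continuous.
move=> /nbhs_ballP[e /= e0 eP].
have t0 : 0 < `|t| + 1 by rewrite ltr_wpDl.
have [n tn] := ltr_add_invr (divr_gt0 e0 t0).
exists (circle_exp (t / n.+1%:R)); last by exists n.+1; exact: circle_exp_div.
apply: eP; rewrite /ball /= sub0r normrN normrM normfV (@gtr0_norm _ n.+1%:R)
  //.
move: tn; rewrite add0r ltr_pdivlMr // mulrC => tn.
by apply: le_lt_trans tn; rewrite ler_wpM2r // lerDl.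
Qed.

Lemma circle_exp_mulz_mem (H : set circle) t (k : int) :
  (forall z w, H z -> H w -> H (circleM z w)) -> (forall z, H z ->
    H (circleV z)) ->
  H circle1 -> H (circle_exp t) -> H (circle_exp (t *~ k)).
Proof.
move=> HM HV H1 Ht; have Hn n : H (circle_exp (t *+ n)).
  by elim: n => [|n IH]; rewrite ?mulr0n ?circle_exp0 // mulrS circle_expD;
    exact: HM.
case: k => n; first exact: Hn.
have -> : circle_exp (t *~ Negz n) = circleV (circle_exp (t *+ n.+1));
  last exact: HV.
have E : circleM (circle_exp (t *~ Negz n)) (circle_exp (t *+ n.+1)) = circle1.
  by rewrite -circle_expD NegzE mulrNz -pmulrn addNr circle_exp0.
apply: val_inj; apply: (mulIf (val_neq0 (circle_exp (t *+ n.+1)))).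
by rewrite [RHS]mulVf ?val_neq0 //; exact: (congr1 val E).
Qed.

(** Pull [H] back to the line by [circle_exp]. If the pullback has arbitrarily small positive
    elements, their multiples make [H] dense, hence full. Otherwise it is generated by a least
    positive element, of which 2 pi is a multiple, and the multiplicity is a common exponent for
    [H]. *)
Lemma closed_subgroup_circle (H : set circle) : closed H -> H circle1 ->
  (forall z w, H z -> H w -> H (circleM z w)) -> (forall z, H z ->
    H (circleV z)) ->
  H = setT \/ exists n, forall z, H z -> val z ^+ n.+1 = 1.
Proof.
move=> cH H1 HM HV.
have [small|/existsNP[d /not_implyP[d0 noH]]] :=
    pselect (forall d : R, 0 < d -> exists2 t, 0 < t < d & H (circle_exp t)).
  left; apply/seteqP; split => // z _; have [s _ <-] := circle_exp_surj z.
  apply: cH => B nB.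
  have : nbhs s (circle_exp @^-1` B) by exact: circle_exp_continuous.
  move=> /nbhs_ballP[e /= e0 eB].
  have [t /andP[t0 te] Ht] := small _ e0.
  exists (circle_exp (t *~ Num.floor (s / t))); split;
    first exact: (circle_exp_mulz_mem _ HM HV H1 Ht).
  apply: eB; rewrite /ball /= -mulrzr.
  have /andP[] := floor_itv (s / t).
  rewrite ler_pdivlMr // ltr_pdivrMr // intrD mulrDl mul1r mulrC => f1 f2.
  by rewrite ger0_norm ?subr_ge0 // ltrBlDl (lt_trans f2) // ltrD2l.
right.
have gap s t : H (circle_exp s) -> H (circle_exp t) -> s < t -> d <= t - s.
  move=> Hs Ht st; rewrite leNgt; apply/negP => tsd; apply: noH.
  exists (t - s); first by rewrite subr_gt0 st.
  rewrite circle_expD; apply: (HM) => //.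
  by have := circle_exp_mulz_mem (-1) HM HV H1 Hs; rewrite mulrN1z.
pose L : set R := [set t | 0 < t /\ H (circle_exp t)].
have L2pi : L (pi *+ 2).
  by split=> /=; rewrite ?circle_exp2pi // mulrn_wgt0 // pi_gt0.
have hL : has_inf L.
  by split; [exists (pi *+ 2)|exists 0 => t [/ltW]].
(* A point of [L] within [d] of the infimum is already the least one, as distinct points of [L] are
   at least [d] apart. *)
have [t [t0 Ht] tL] := inf_adherent d0 hL.
have tmin s : L s -> t <= s.
  move=> [s0 Hs]; rewrite leNgt; apply/negP => st.
  have := gap _ _ Hs Ht st; apply/negP; rewrite -ltNge ltrBlDr addrC.
  by rewrite (lt_le_trans tL) // lerD2r; apply: ge_inf; [case: hL|split].
have tmul s : H (circle_exp s) -> s = t *~ Num.floor (s / t).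
  move=> Hs; have /andP[] := floor_itv (s / t).
  rewrite ler_pdivlMr // ltr_pdivrMr // intrD mulrDl mul1r !(mulrC _ t).
  rewrite !mulrzr => f1 f2; apply/eqP; rewrite eq_le f1 andbT leNgt.
  apply/negP => f3.
  have /tmin : L (s - t *~ Num.floor (s / t)).
    split; first by rewrite subr_gt0.
    rewrite circle_expD; apply: (HM) => //.
    by rewrite -mulrNz; exact: (circle_exp_mulz_mem _ HM HV H1 Ht).
  by rewrite leNgt ltrBlDl f2.
have := tmul _ L2pi.2; set N := Num.floor _ => EN.
have : 0 < t *~ N by rewrite -EN; exact: L2pi.1.
case: N EN => [[|n]|n] EN; rewrite ?mulr0z ?ltxx //; last first.
  by rewrite NegzE mulrNz oppr_gt0 -pmulrn => /ltW;
    rewrite leNgt pmulrn_lgt0 // t0.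
move=> _; exists n => z Hz; have [s _ sz] := circle_exp_surj z.
have Hs : H (circle_exp s) by rewrite sz.
rewrite -sz -circle_expMn (tmul _ Hs).
have -> : t *~ Num.floor (s / t) *+ n.+1 = pi *+ 2 *~ Num.floor (s / t).
  by rewrite EN !pmulrn -!mulrzA mulrC.
have -> : circle_exp (pi *+ 2 *~ Num.floor (s / t)) = circle1 => //.
apply: (@circle_exp_mulz_mem [set z | z = circle1]) => //=;
  last exact: circle_exp2pi.
  by move=> ? ? -> ->; apply: val_inj; rewrite /= mulr1.
by move=> ? ->; apply: val_inj; rewrite /= invr1.
Qed.

Definition irrational_rotation (z : circle) := forall n, val z ^+ n.+1 <> 1.

(** The translations that preserve [A] together with their inverses form a closed subgroup
    containing [z]. As [z] has infinite order, this subgroup is the whole circle. *)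
Lemma irrational_rotation_closed (z : circle) (A : set circle) :
  irrational_rotation z -> closed A -> A !=set0 ->
  (forall w, A w -> A (circleM z w)) -> (forall w, A w ->
    A (circleM (circleV z) w)) ->
  A = setT.
Proof.
move=> zirr cA [a Aa] Az AzV.
pose H : set circle := [set t | forall w, A w ->
  A (circleM t w) /\ A (circleM (circleV t) w)].
have circleMC : forall u v, circleM u v = circleM v u.
  by move=> u v; apply: val_inj; rewrite /= mulrC.
have cmul_cont w : continuous (circleM^~ w).
  apply/to_circle_continuous/(mul_continuous_fun val_continuous).
  exact: cst_continuous_fun.
have cinv_cont : continuous circleV.
  exact/to_circle_continuous/(inv_continuous_fun val_continuous)/val_neq0.
have [||||HT|[n Hn]] := @closed_subgroup_circle H.
- have -> : H = \bigcap_(w in A)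
      (circleM^~ w @^-1` A `&` circleV @^-1` (circleM^~ w @^-1` A)).
    by apply/seteqP; split => t /= Ht w /Ht.
  apply: closed_bigI => w _; apply: closedI.
    by apply: closed_comp => // ? _; exact: cmul_cont.
  apply: closed_comp => [? _|]; first exact: cinv_cont.
  by apply: closed_comp => // ? _; exact: cmul_cont.
- move=> w Aw; have -> : circleM circle1 w = w by apply: val_inj;
  rewrite /= mul1r.
  by split=> //; have -> : circleM (circleV circle1) w = w by apply: val_inj;
    rewrite /= invr1 mul1r.
- move=> u v Hu Hv w Aw; split.
    have -> : circleM (circleM u v) w = circleM u (circleM v w).
      by apply: val_inj; rewrite /= mulrA.
    by apply: (Hu _ _).1; apply: (Hv _ _).1.
  have -> : circleM (circleV (circleM u v)) w = circleM (circleV u) (circleM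
    (circleV v) w).
    by apply: val_inj; rewrite /= invfM mulrA.
  by apply: (Hu _ _).2; apply: (Hv _ _).2.
- move=> u Hu w Aw; split; first exact: (Hu _ _).2.
  have -> : circleM (circleV (circleV u)) w = circleM u w.
    by apply: val_inj; rewrite /= invrK.
  exact: (Hu _ _).1.
- apply/seteqP; split => // w _.
  have : H (circleM w (circleV a)) by rewrite HT.
  move=> /(_ a Aa)[+ _]; congr A; apply: val_inj => /=.
  by rewrite mulfVK // val_neq0.
- by exfalso; apply: (zirr n); apply: Hn => w Aw; split; [exact: Az|exact: AzV].
Qed.

(** Since l^2 - 1 = (l - 1)(l + 1), squaring a number within 1/2 of 1 multiplies its distance to 1
    by at least 3/2. Repeated squaring of some [l <> 1] would therefore leave the disc of radius
    1/2. *)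
Lemma exp_near1 (l : C) : `|l| = 1 -> (forall n, `|l ^+ n - 1| <= 2^-1) ->
  l = 1.
Proof.
move=> l1 ln; apply/eqP; rewrite -subr_eq0 -normr_eq0; apply/eqP.
pose q : R := complex.Re `|l - 1|.
have qE : `|l - 1| = (q%:C)%C by rewrite RRe_real // normr_real.
have q0 : 0 <= q by rewrite -lecR -qE normr_ge0.
suff : q = 0 by rewrite qE => ->.
apply/eqP; rewrite eq_le q0 andbT leNgt; apply/negP => qgt0.
have h32 : ((3 / 2)%:C)%C = 3 / 2 :> C.
  by rewrite rmorphM /= fmorphV !rmorph_nat.
have grow k : ((q * (3 / 2) ^+ k)%:C)%C <= `|l ^+ (2 ^ k) - 1|.
  elim: k => [|k IH]; first by rewrite expr0 mulr1 expn0 expr1 qE.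
  rewrite expnSr exprM -[1 in leRHS](expr1n _ 2) subr_sqr normrM.
  have -> : ((q * (3 / 2) ^+ k.+1)%:C)%C =
    ((q * (3 / 2) ^+ k)%:C)%C * ((3 / 2)%:C)%C :> C.
    by rewrite exprSr (mulrA q); exact: (rmorphM (real_complex R)).
  apply: ler_pM => //.
  - by rewrite ler0c mulr_ge0 // exprn_ge0 // divr_ge0.
  - by rewrite ler0c divr_ge0.
  have : `|2 : C| - `|1 - l ^+ (2 ^ k)| <= `|2 - (1 - l ^+ (2 ^ k))|.
    exact: lerB_dist.
  have -> : 2 - (1 - l ^+ (2 ^ k)) = l ^+ (2 ^ k) + 1 by ring.
  apply: le_trans; rewrite distrC lerBrDr.
  apply: (@le_trans _ _ (((3 / 2)%:C)%C + 2^-1)); first by rewrite lerD2l.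
  rewrite normr_nat h32 -{2}[2^-1]mul1r -mulrDl.
  by rewrite ler_pdivrMr // -natrM -[1]/(1%:R) -natrD ler_nat.
have bern k : 1 + k%:R / 2 <= (3 / 2 : R) ^+ k.
  elim: k => [|k IH]; first by rewrite expr0 mul0r addr0.
  have := ler0n R k; rewrite exprS -natr1; move: IH.
  by set P := _ ^+ k; set x := k%:R; lra.
have bound k : q * (3 / 2) ^+ k <= 2^-1.
  rewrite -lecR; apply: (le_trans (grow k)); apply: le_trans (ln _) _.
  by rewrite fmorphV rmorph_nat.
have := bound (Num.trunc q^-1).+1; apply/negP; rewrite -ltNge.
have := truncnS_gt q^-1; set k := _.+1 => qk.
have bk := bern k.
apply: (@lt_le_trans _ _ (q * (1 + k%:R / 2))); last by rewrite ler_pM2l.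
have : 1 < q * k%:R by rewrite -ltr_pdivrMl // mulr1.
by nra.
Qed.

End Circle.

Arguments circle R : clear implicits.

(** * Minimal closed sets *)

Section ZornClosed.
Variable T : topologicalType.

(** [Zorn_bigcup] gives maximal elements for unions of chains, so it is applied to complements.
    Intersecting with [A] in [Q] keeps the minimal set inside [A]. *)
Lemma minimal_closed (P : set (set T)) (A : set T) :
  (forall F : set (set T), F !=set0 ->
     (forall B, F B -> closed B /\ P B) -> total_on F subset ->
     P (\bigcap_(B in F) B)) ->
  closed A -> P A ->
  exists M, [/\ closed M, P M, M `<=` A &
    forall N, closed N -> P N -> N `<=` M -> N = M].
Proof.
move=> chainP cA PA.
pose Q : set (set T) := [set B | closed (~` B) /\ P (~` B `&` A)].
have [F FQ Ftot|B [[cB PB] maxB]] := @Zorn_bigcup T Q.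
  have [F0|/set0P[B0 FB0]] := eqVneq F set0.
    rewrite F0 bigcup_set0 /Q /= setC0 setTI; split => //; exact: closedT.
  split; first by rewrite setC_bigcup; apply: closed_bigI => B /FQ[].
  have -> : ~` (\bigcup_(X in F) X) `&` A =
      \bigcap_(B in [set ~` X `&` A | X in F]) B.
    rewrite bigcap_image setC_bigcup; apply/seteqP; split => x /=.
      by move=> [Fx Ax] B FB; split => //; exact: Fx.
    by move=> Fx; split => [B /Fx[]|]; last by case: (Fx _ FB0).
  apply: chainP.
  - by exists (~` B0 `&` A), B0.
  - by move=> _ [X /FQ[cX PX] <-]; split => //; exact: closedI.
  - move=> _ _ [X FX <-] [Y FY <-]; have [XY|YX] := Ftot _ _ FX FY.
      by right; apply: setSI; exact: subsetC.
    by left; apply: setSI; exact: subsetC.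
exists (~` B `&` A); split => //; first exact: closedI.
move=> N cN PN NB; apply/seteqP; split => //.
have : ~ (B `<` ~` N).
  move=> /maxB; apply; rewrite /Q /= setCK; split => //.
  by rewrite (_ : N `&` A = N) //; apply/setIidPl => x /NB[].
move=> BN x [Bx Ax]; apply: contrapT => Nx; apply: BN; split.
  by move=> y By Ny; case: (NB _ Ny).
by move=> NB'; apply: Bx; exact: NB'.
Qed.

(** If the intersection missed [K], each point would have a neighbourhood containing no point common
    to [K] and [B], for all small [B] in the chain. Compactness, applied with the filter [G] of
    tails of the chain, would give one [B] disjoint from [K]. *)
Lemma compact_chain (F : set (set T)) (K : set T) : compact [set: T] ->
  closed K -> F !=set0 -> (forall B, F B -> closed B /\ B `&` K !=set0) ->
  total_on F subset -> (\bigcap_(B in F) B) `&` K !=set0.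
Proof.
move=> cT cK [B0 FB0] FK Ftot; apply: contrapT => /set0P/negP/negPn/eqP F0.
pose G : set (set (set T)) :=
  [set Q | exists2 A, F A & forall B, F B -> B `<=` A -> Q B].
have GF : Filter G.
  split.
  - by exists B0.
  - move=> Q1 Q2 [A1 FA1 Q1A] [A2 FA2 Q2A].
    have [A12|A21] := Ftot _ _ FA1 FA2.
      by exists A1 => // B FB BA; split; [exact: Q1A|apply: Q2A => // x
        /BA/A12].
    by exists A2 => // B FB BA; split; [apply: Q1A => // x /BA/A21|exact: Q2A].
  - by move=> Q1 Q2 Q12 [A FA QA]; exists A => // B FB BA; apply/Q12/QA.

have [|A FA AP] :=
  (compact_near_coveringP setT).1 cT _ G (fun B x => ~ (B `&` K) x) GF.
  move=> x _; have : ~ ((\bigcap_(B in F) B) `&` K) x by rewrite F0.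
  have [Kx|nKx] := pselect (K x); last first.
    move=> _; exists (~` K, setT) => /=; last by move=> [y B] /= [Ky _] [].
    by split; [exact: (open_nbhs_nbhs (conj (closed_openC cK) nKx))|exact:
      filterT].
  move=> nFx; have [B FB nBx] : exists2 B, F B & ~ B x.
    apply: contrapT => h; apply: nFx; split => // B FB.
    by apply: contrapT => nBx; apply: h; exists B.
  exists (~` B, [set B' | B' `<=` B]) => /=; last first.
    by move=> [y B'] /= [By B'B] [/B'B].
  split; first exact: (open_nbhs_nbhs (conj (closed_openC (FK _ FB).1) nBx)).
  by exists B.
have [_ [x ABx]] := FK _ FA.
exact: (AP _ FA (@subset_refl _ A) x I ABx).
Qed.

End ZornClosed.

(** * The Stone-Weierstrass theorem *)

Section Modulus.
Variable R : realType.
Local Notation C := (C R).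

(** The norm on [C R] takes its values in [C R]; this is the same modulus read in [R], where the
    estimates are carried out. *)
Definition cabs (z : C) : R := complex.Re `|z|.

Lemma cabsE z : (cabs z)%:C%C = `|z|.
Proof. by rewrite RRe_real // normr_real. Qed.

Lemma cabs_ge0 z : 0 <= cabs z.
Proof. by rewrite -ler0c cabsE. Qed.

Lemma cabsM z w : cabs (z * w) = cabs z * cabs w.
Proof. by apply: complexI; rewrite rmorphM /= !cabsE normrM. Qed.

Lemma ler_cabsD z w : cabs (z + w) <= cabs z + cabs w.
Proof. by rewrite -lecR rmorphD /= !cabsE ler_normD. Qed.

Lemma cabs0 : cabs 0 = 0.
Proof. by rewrite /cabs normr0. Qed.

Lemma cabs_eq0 z : (cabs z == 0) = (z == 0).
Proof.
apply/eqP/eqP => [z0|->]; last exact: cabs0.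
by apply/eqP; rewrite -normr_eq0 -cabsE z0.
Qed.

Lemma cabs_real (x : R) : 0 <= x -> cabs (x%:C)%C = x.
Proof. by move=> x0; rewrite /cabs ger0_norm // ler0c. Qed.

Lemma cabs_continuous_fun (T : topologicalType) (f : T -> C) :
  continuous f -> continuous (fun x => cabs (f x) : R).
Proof.
move=> cf x; apply: (@continuous_comp _ _ _ (fun x => `|f x|) _); last first.
  exact: Re_continuous.
apply: (@continuous_comp _ _ _ f _); first exact: cf.
exact: norm_continuous.
Qed.

Lemma closed_le_fun (T : topologicalType) (f : T -> R) (a : R) :
  continuous f -> closed [set x | f x <= a].
Proof.
move=> cf; have -> : [set x | f x <= a] = f @^-1` [set x | x <= a] by [].
by apply: closed_comp => [x _|]; [exact: cf|exact: closed_le].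
Qed.

Lemma closed_ge_fun (T : topologicalType) (f : T -> R) (a : R) :
  continuous f -> closed [set x | a <= f x].
Proof.
move=> cf; have -> : [set x | a <= f x] = f @^-1` [set x | a <= x] by [].
by apply: closed_comp => [x _|]; [exact: cf|exact: closed_ge].
Qed.

End Modulus.

(** * Bernoulli inequalities for the sharpening powers *)

Section Bernoulli.
Variable R : realType.
Implicit Type t : R.

Lemma bernoulli_ge t N : 0 <= t <= 1 -> 1 - N%:R * t <= (1 - t) ^+ N.
Proof.
move=> /andP[t0 t1]; elim: N => [|N IH]; first by rewrite mul0r subr0 expr0.
have N0 := ler0n R N.
rewrite exprSr -natr1; apply: (@le_trans _ _ ((1 - N%:R * t) * (1 - t))).
  by nra.
by rewrite ler_wpM2r // subr_ge0.
Qed.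

Lemma bernoulli_le t N : 0 <= t <= 1 -> (1 - t) ^+ N * (1 + N%:R * t) <= 1.
Proof.
move=> /andP[t0 t1]; elim: N => [|N IH]; first by rewrite mul0r addr0 expr0
  mulr1.
have N0 := ler0n R N.
apply: le_trans IH; rewrite exprSr -mulrA -natr1 ler_wpM2l //.
  by rewrite exprn_ge0 // subr_ge0.
by nra.
Qed.

(* The powers (1 - h^n)^(2^n) tend to 1 where h <= 1/3 and to 0 where
   h >= 2/3. *)
Lemma sharpen_near1 t n : 0 <= t <= 3^-1 ->
  1 - (1 - t ^+ n) ^+ (2 ^ n) <= (3 / 4) ^+ n.
Proof.
move=> /andP[t0 t1].
have t1' : t <= 1 by apply: le_trans t1 _; rewrite invf_le1 // ler1n.
have tn : 0 <= t ^+ n <= 1 by rewrite exprn_ge0 // exprn_ile1.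
have := bernoulli_ge (2 ^ n) tn; rewrite natrX -exprMn => b.
(* The base 3/4 serves both ends: here [2 * t] is at most 2/3, and at the other end it is at least
   4/3, the inverse of 3/4. *)
have : (2 * t) ^+ n <= (3 / 4) ^+ n by rewrite lerXn2r ?nnegrE; lra.
by lra.
Qed.

Lemma sharpen_near0 t n : 2 / 3 <= t <= 1 -> (1 - t ^+ n) ^+ (2 ^ n) <= (3 / 4)
  ^+ n.
Proof.
move=> /andP[t0 t1].
have t0' : 0 <= t by lra.
have tn : 0 <= t ^+ n <= 1 by rewrite exprn_ge0 // exprn_ile1.
have := bernoulli_le (2 ^ n) tn; rewrite natrX -exprMn => b.
have q1 : (4 / 3) ^+ n <= (2 * t) ^+ n by rewrite lerXn2r ?nnegrE; lra.
have -> : (3 / 4 : R) = (4 / 3)^-1 by rewrite invf_div.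
have q0 : 0 < (4 / 3 : R) ^+ n by rewrite exprn_gt0 // divr_gt0.
rewrite exprVn -[leRHS]mul1r ler_pdivlMr //; apply: le_trans b.
rewrite ler_wpM2l //; first by rewrite exprn_ge0 // subr_ge0; case/andP: tn.
by lra.
Qed.

Lemma expr_lt_near0 (q c : R) : 0 <= q < 1 -> 0 < c -> exists n, q ^+ n < c.
Proof.
move=> /andP[q0 q1] c0.
have nq : `|q| < 1 by rewrite ger0_norm.
have /cvgrPdist_lt/(_ _ c0)[n _ nP] := cvg_expr nq.
exists n; have := nP n (leqnn n).
by rewrite /= sub0r normrN ger0_norm // exprn_ge0.
Qed.

End Bernoulli.

(** * Density of a separating self-adjoint algebra *)

Section StoneWeierstrass.
Variables (R : realType) (T : topologicalType).
Local Notation C := (C R).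
Hypothesis cT : compact [set: T].
Variable A : set (T -> C).
Hypothesis A_continuous : forall g, A g -> continuous g.
Hypothesis A_cst : forall c : C, A (fun=> c).
Hypothesis A_add : forall g h, A g -> A h -> A (fun x => g x + h x).
Hypothesis A_mul : forall g h, A g -> A h -> A (fun x => g x * h x).
Hypothesis A_conj : forall g, A g -> A (fun x => ((g x)^*)%C).
Hypothesis A_sep : forall x y, x <> y -> exists2 g, A g & g x <> g y.

Lemma algebra_exp g n : A g -> A (fun x => g x ^+ n).
Proof.
move=> Ag; elim: n => [|n IH].
  by rewrite (_ : (fun _ => _) = (fun=> 1)) //; apply/funext => x;
    rewrite expr0.
rewrite (_ : (fun _ => _) = (fun x => g x * g x ^+ n)); first exact: A_mul.
by apply/funext => x; rewrite exprS.
Qed.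

Lemma algebra_sub g h : A g -> A h -> A (fun x => g x - h x).
Proof.
move=> Ag Ah; rewrite (_ : (fun _ => _) = (fun x => g x + (-1) * h x)).
  by apply: A_add => //; exact: (A_mul (A_cst (-1))).
by apply/funext => x; rewrite mulN1r.
Qed.

Section NonApproximable.
Variables (f : T -> C) (e : R).
Hypotheses (cf : continuous f) (e0 : 0 < e).

(** The uniform distance from [f] to [A] over [M] is at least [e]. Nonempty intersections with
    closed sets replace a supremum, so that compactness passes the property to intersections of
    chains. *)
Let P (M : set T) := forall g d, A g -> 0 < d ->
  M `&` [set x | e - d <= cabs (f x - g x)] !=set0.

Let dist_continuous g : A g -> continuous (fun x => cabs (f x - g x) : R).
Proof.
move=> Ag; apply: (cabs_continuous_fun (f := fun x => f x - g x)).
exact: sub_continuous_fun cf (A_continuous Ag).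
Qed.

Let bounded_dist g : A g -> exists2 b, 0 < b & forall x, cabs (f x - g x) <= b.
Proof.
move=> Ag; have [T0|T0] := pselect ([set: T] !=set0); last first.
  by exists 1 => // x; case: T0; exists x.
have [|c _ cmax] := @compact_EVT_max T R (fun x => cabs (f x - g x)) setT T0 cT.
  by apply: continuous_subspaceT; exact: dist_continuous.
exists (cabs (f c - g c) + 1); first by rewrite ltr_wpDl // cabs_ge0.
by move=> x; rewrite (le_trans (cmax x (in_setT _))) // lerDl.
Qed.

(* A set on which f keeps distance e from A, minimal among the closed sets, is
   split by any member of A which is not constant on it (Machado, Ransford). *)
Lemma not_far_from_algebra : ~ P setT.
Proof.
move=> PT.
have [F F0 FP Ftot|M [cM PM _ Mmin]] := @minimal_closed T P setT _ closedT PT.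
  move=> g d Ag d0; apply: compact_chain => //.
    by apply: closed_ge_fun; exact: dist_continuous.
  by move=> B FB; split; [exact: (FP _ FB).1|exact: (FP _ FB).2].
have [x [Mx _]] := PM (fun=> 0) 1 (A_cst 0) ltr01.
(* On a single point [x] the constant [f x] would be an exact approximation, so [M] has a second
   point. *)
have [y My yx] : exists2 y, M y & x <> y.
  apply: contrapT => h.
  have e20 : 0 < e / 2 by rewrite divr_gt0.
  have [y [My]] := PM (fun=> f x) (e / 2) (A_cst _) e20.
  have <- : x = y by apply: contrapT => xy; apply: h; exists y.
  by rewrite /= subrr cabs0; lra.
have [g Ag gxy] := A_sep yx.
(* [u] vanishes at [x] and is positive at [y]. Being a member of [A] times its conjugate, it gives a
   member of [A], and so does its normalisation [h], which maps [M] into [0, 1]. *)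
pose u z := cabs (g z - g x) ^+ 2.
have cu : continuous u.
  move=> z; apply: (@continuous_comp T R R (fun z => cabs (g z - g x))
    (fun r => r ^+ 2)); last first.
    exact: exprn_continuous.
  apply: (cabs_continuous_fun (f := fun z => g z - g x)).
  exact: A_continuous (algebra_sub Ag (A_cst _)).
have [|c Mc cmax] := @compact_EVT_max T R u M (ex_intro _ x Mx)
    (@subclosed_compact T M setT cM cT (@subsetT _ M)).
  exact: continuous_subspaceT.
have s0 : 0 < u c.
  have : 0 < u y.
    rewrite exprn_gt0 // lt_def cabs_ge0 andbT cabs_eq0 subr_eq0.
    by apply/eqP => E; apply: gxy; rewrite E.
  by move/lt_le_trans; apply; apply: cmax; exact: mem_set.
pose h z := u z / u c.
have ch : continuous h by move=> z; apply: cvgM; [exact: cu|exact: cvg_cst].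
have h01 z : M z -> 0 <= h z <= 1.
  move=> Mz; rewrite divr_ge0 ?exprn_ge0 ?cabs_ge0 ?(ltW s0) //=.
  by rewrite ler_pdivrMr // mul1r; apply: cmax; exact: mem_set.
have Ah : A (fun z => (h z)%:C%C).
  rewrite (_ : (fun _ => _) = (fun z =>
      (g z - g x) * ((g z - g x)^*)%C * ((u c)^-1%:C)%C)); last first.
    by apply/funext => z; rewrite rmorphM rmorphXn /= cabsE sqr_normc.
  apply: A_mul (A_cst _); apply: A_mul; first exact: algebra_sub.
  exact: (A_conj (algebra_sub Ag (A_cst _))).
have notP (N : set T) : closed N -> N `<=` M -> N <> M ->
    exists g d, [/\ A g, 0 < d & forall z, N z -> cabs (f z - g z) <= e - d].
  move=> cN NM NneM; apply: contrapT => nex; apply/NneM/Mmin => // k d Ak d0.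
  apply: contrapT => Nk; apply: nex; exists k, d; split => // z Nz.
  by rewrite leNgt; apply/negP => /ltW lez; apply: Nk; exists z.
(* The two pieces overlap where [h] is between 1/3 and 2/3. Each is proper: the first omits the
   maximum point [c], the second the zero [x]. *)
have [|||k [d1 [Ak d10 kP]]] := notP (M `&` [set z | h z <= 2 / 3]).
- by apply: closedI => //; exact: closed_le_fun.
- exact: subIsetl.
- move=> E; have : M c by exact: set_mem.
  by rewrite -E => -[_] /=; rewrite /h divff ?gt_eqF //; lra.
have [|||l [d2 [Al d20 lP]]] := notP (M `&` [set z | 3^-1 <= h z]).
- by apply: closedI => //; exact: closed_ge_fun.
- exact: subIsetl.
- move=> E; have := Mx.
  by rewrite -E => -[_] /=; rewrite /h /u subrr cabs0 expr0n /= mul0r; lra.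
have [b1 b10 b1P] := bounded_dist Ak.
have [b2 b20 b2P] := bounded_dist Al.
pose d := Num.min d1 d2; pose b := b1 + b2.
have d0 : 0 < d by rewrite lt_min d10.
have dd1 : d <= d1 by rewrite ge_min lexx.
have dd2 : d <= d2 by rewrite ge_min lexx orbT.
have b0 : 0 < b by rewrite addr_gt0.
have q01 : 0 <= (3 / 4 : R) < 1 by lra.
(* This [n] makes the error of [H] at either end, times the bound [b] on both distances, less than
   d/4. *)
have [n nP] := expr_lt_near0 q01 (divr_gt0 d0 (mulr_gt0 b0 (ltr0Sn R 3))).
pose H z := (1 - h z ^+ n) ^+ (2 ^ n).
have AH : A (fun z => (H z)%:C%C).
  rewrite (_ : (fun _ => _) = (fun z => (1 - (h z)%:C%C ^+ n) ^+ (2 ^ n))).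
    by apply: algebra_exp; apply: algebra_sub; [exact: A_cst|exact:
      algebra_exp].
  by apply/funext => z; rewrite rmorphXn rmorphB rmorphXn.
(* [G] blends the two approximations: it is close to [k] where [h] is small and to [l] where [h] is
   large. *)
pose G z := (H z)%:C%C * k z + (1 - (H z)%:C%C) * l z.
have AG : A G.
  apply: A_add; first exact: A_mul.
  by apply: A_mul => //; apply: algebra_sub => //; exact: A_cst.
have [z [Mz]] := PM G (d / 4) AG (divr_gt0 d0 (ltr0Sn R 3)).
rewrite /=; apply/negP; rewrite -ltNge.
have /andP[h0 h1] := h01 z Mz.
have H0 : 0 <= H z by rewrite exprn_ge0 // subr_ge0 exprn_ile1.
have H1 : H z <= 1.
  by rewrite exprn_ile1 ?subr_ge0 ?exprn_ile1 // lerBlDr lerDl exprn_ge0.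
have : cabs (f z - G z) <= H z * cabs (f z - k z) + (1 - H z) * cabs (f z - l
  z).
  have -> : f z - G z = (H z)%:C%C * (f z - k z) + (1 - H z)%:C%C * (f z - l z).
    by rewrite rmorphB /= /G; ring.
  apply: le_trans (ler_cabsD _ _) _.
  by rewrite !cabsM !cabs_real // subr_ge0.
move=> /le_lt_trans; apply.
have := b1P z; have := b2P z; have := kP z; have := lP z.
have K0 := cabs_ge0 (f z - k z); have L0 := cabs_ge0 (f z - l z).
move: K0 L0; set K := cabs (f z - k z); set L :=
  cabs (f z - l z) => K0 L0 lL kK L2 K1.
move: nP; rewrite ltr_pdivlMr ?mulr_gt0 // => nP.
have [hz|hz] := leP (h z) 3^-1.
  have /kK Kd : (M `&` [set z | h z <= 2 / 3]) z by split => //=; lra.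
  have := @sharpen_near1 R (h z) n; rewrite h0 hz -/(H z) => /(_ isT) HH.
  have : (1 - H z) * L <= (1 - H z) * b by rewrite ler_wpM2l ?subr_ge0 // /b;
    lra.
  have : (1 - H z) * b <= (3 / 4) ^+ n * b by rewrite ler_wpM2r // ltW.
  have : H z * K <= K by rewrite ler_piMl.
  move: nP; set Q := (3 / 4) ^+ n; lra.
have /lL Ld : (M `&` [set z | 3^-1 <= h z]) z by split => //=; exact: ltW.
have [hz2|hz2] := leP (h z) (2 / 3).
  (* In the overlap both approximations are good, so a convex combination is good whatever the value
     of [H]. *)
  have /kK Kd : (M `&` [set z | h z <= 2 / 3]) z by split.
  have : H z * K <= H z * (e - d) by rewrite ler_wpM2l //; lra.
  have : (1 - H z) * L <= (1 - H z) * (e - d) by rewrite ler_wpM2l ?subr_ge0 //;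
    lra.
  lra.
have := @sharpen_near0 R (h z) n; rewrite h1 (ltW hz2) -/(H z) => /(_ isT) HH.
have : H z * K <= H z * b by rewrite ler_wpM2l // /b; lra.
have : H z * b <= (3 / 4) ^+ n * b by rewrite ler_wpM2r // ltW.
have : (1 - H z) * L <= L by rewrite ler_piMl // ?subr_ge0 // lerBlDr lerDl.
move: nP; set Q := (3 / 4) ^+ n; lra.
Qed.

End NonApproximable.

Theorem stone_weierstrass (f : T -> C) (e : R) : continuous f -> 0 < e ->
  exists2 g, A g & forall x, cabs (f x - g x) <= e.
Proof.
move=> cf e0; apply: contrapT => nex; apply: (not_far_from_algebra cf e0) => g d
  Ag d0.
apply: contrapT => nx; apply: nex; exists g => // x.
rewrite leNgt; apply/negP => ex; apply: nx; exists x; split => //=.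
by rewrite lerBlDr (le_trans (ltW ex)) // lerDl ltW.
Qed.

End StoneWeierstrass.

(** * Quasi-eigenfunctions of minimal systems *)

Lemma closed_eq_fun (T : topologicalType) (R : realType) (f g : T -> C R) :
  continuous f -> continuous g -> closed [set x | f x = g x].
Proof.
move=> cf cg.
have -> : [set x | f x = g x] = [set x | cabs (f x - g x) <= 0].
  apply/seteqP; split => x /=; first by move=> ->; rewrite subrr cabs0.
  move=> h; apply/eqP; rewrite -subr_eq0 -cabs_eq0 eq_le h /=; exact: cabs_ge0.
apply: closed_le_fun; apply: (cabs_continuous_fun (f := fun x => f x - g x)).
exact: sub_continuous_fun cf cg.
Qed.

Section InvariantSets.
Variable X : dynSys.

Definition invariant_set (M : set X) :=
  (forall x, M x -> M (shift x)) /\ (forall x, M x -> M (shiftV x)).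

Lemma invariant_shiftz (M : set X) n x : invariant_set M -> M x ->
  M (shiftz n x).
Proof.
move=> [MS MV] Mx; case: n => n; elim: n => [|n IH] //=;
  [exact: MS|exact: MV|exact: MV].
Qed.

Lemma orbit_closure_invariant (x : X) : invariant_set (closure (orbitz x)).
Proof.
have sub h : continuous h -> (forall n, exists m, h \o shiftz n = @shiftz X m)
  ->
    forall y, closure (orbitz x) y -> closure (orbitz x) (h y).
  move=> hc hz y xy B nB; have [_ [[n _ <-] Bn]] := xy _ (hc y _ nB).
  exists (h (shiftz n x)); split => //.
  by have [m hm] := hz n; exists m => //; rewrite -hm.
split; apply: sub.
- exact: shift_continuous.
- exact: shift_shiftz.
- exact: shiftV_continuous.
- exact: shiftV_shiftz.
Qed.

(** By Zorn's lemma every orbit closure contains a minimal closed invariant set. If such a set is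
    always the whole space, every orbit is dense. *)
Lemma minimal_sys_of_minimal_sets :
  (forall M : set X, closed M -> M !=set0 -> invariant_set M ->
    (forall N, closed N -> N !=set0 -> invariant_set N -> N `<=` M -> N = M) ->
    M = setT) -> minimal_sys X.
Proof.
move=> minP x O O0 oO; apply: contrapT => Ox.
pose P (M : set X) := M !=set0 /\ invariant_set M.
have [|||M [cM [M0 MI] MA Mmin]] :=
    @minimal_closed X P (closure (orbitz x)).
- move=> F F0 FP Ftot; split.
    have [|y [Fy _]] := @compact_chain X F setT (@space_compact X) closedT F0 _
      Ftot.
      by move=> B /FP[cB [B0 _]]; split => //; rewrite setIT.
    by exists y.
  by split => y Fy B FB; have [_ [_ BI]] := FP _ FB; apply BI; exact: Fy.
- exact: closed_closure.
- split; last exact: orbit_closure_invariant.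
  by exists x; apply: subset_closure; exists 0.
have MT : M = setT.
  by apply: minP => // N cN N0 NI NM; apply: Mmin.
have [y Oy] := O0.
have /MA/(_ O) : M y by rewrite MT.
case; first exact: open_nbhs_nbhs.
by move=> z [xz Oz]; apply: Ox; exists z.
Qed.

Lemma minimal_invariant_const (R : realType) (h : X -> C R) :
  minimal_sys X -> continuous h -> (forall x, h (shift x) = h x) ->
  forall x y, h x = h y.
Proof.
move=> mX ch hT x y; apply: contrapT => hxy.
have oO : open (~` [set z | h x = h z]).
  apply: closed_openC.
  exact: (@closed_eq_fun X R (fun=> h x) h (@cst_continuous_fun R X (h x)) ch).
have [|z [hz [n _ nz]]] := mX x _ _ oO; first by exists y.
apply: hz => /=; rewrite -nz.
have inv : invariant_set [set z | h x = h z].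
  by split => w /= ->; rewrite ?hT // -{1}(shiftVK w) hT.
exact: (invariant_shiftz n inv (erefl (h x))).
Qed.

End InvariantSets.

(** * Eigenvalues and flows close to the identity *)

Section Near1.
Variable R : realType.
Local Notation C := (C R).

(** Since l^n - 1 = (h(S^n x) - 1) - l^n (h(x) - 1), all powers of [l] stay within 1/4 + 1/4 of 1,
    and [exp_near1] applies. *)
Lemma eigenvalue_near1 (T : Type) (S : T -> T) (h : T -> C) (l : C) (x : T) :
  `|l| = 1 -> (forall n, h (iter n S x) = l ^+ n * h x) ->
  (forall y, `|h y - 1| <= 4^-1) -> l = 1.
Proof.
move=> l1 hn hnear; apply: exp_near1 => // n.
have -> : l ^+ n - 1 = (h (iter n S x) - 1) - l ^+ n * (h x - 1).
  by rewrite hn; ring.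
apply: le_trans (ler_normB _ _) _.
rewrite normrM normrX l1 expr1n mul1r.
apply: le_trans (lerD (hnear _) (hnear _)) _.
have -> : 4^-1 + 4^-1 = 2^-1 :> C by field.
exact: lexx.
Qed.

(** The quotient is jointly continuous and equals 1 at [r = 1]; compactness of [T] makes the
    estimate uniform in [x]. *)
Lemma flow_near1 (T : topologicalType) (S : circle R -> T -> T) (g : T ->
  C) (e : C) :
  compact [set: T] -> continuous (fun p : circle R * T => S p.1 p.2) ->
  (forall x, S (circle1 R) x = x) -> continuous g -> (forall x, g x != 0) ->
    0 < e ->
  \forall r \near circle1 R,
    [set: T] `<=` (fun x => `|g (S r x) / g x - 1| <= e).
Proof.
move=> cT cS S1 cg g0 e0.
apply: ((compact_near_coveringP setT).1 cT (circle R) (nbhs (circle1 R))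
  (fun r x => `|g (S r x) / g x - 1| <= e) (nbhs_filter (circle1 R))).
move=> x _.
have cq : continuous (fun p : T * circle R => g (S p.2 p.1) / g p.1).
  apply: (@mul_continuous_fun R _ (fun p : T * circle R => g (S p.2 p.1))
    (fun p => (g p.1)^-1)).
    move=> p; apply: (@continuous_comp _ _ _ (fun p => S p.2 p.1));
      last exact: cg.
    apply: (@continuous_comp _ _ _ (fun p : T * circle R => (p.2, p.1)) (fun p
      => S p.1 p.2)).
      exact: swap_continuous.
    exact: cS.
  apply: inv_continuous_fun => // p.
  by apply: (@continuous_comp _ _ _ fst g); [exact: cvg_fst|exact: cg].
have := cq (x, circle1 R); rewrite /continuous_at /= S1 divff //.
move=> /(_ _ (nbhsx_ballx (1 : C) _ e0)) [[U V] [nU nV] UV].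
exists (U, V) => // -[y r] yr /=; apply: ltW.
by have := UV _ yr; rewrite /ball /= distrC.
Qed.

End Near1.

(** * Group structure and rigidity of quasi-eigenfunctions *)

Section QuasiEigen.
Variables (R : realType) (X : dynSys).
Local Notation C := (C R).

Lemma quasi_eigen_circle m (g : X -> C) : quasi_eigen m g -> circle_valued g.
Proof.
case: m => [[c c1 ->]|m []//]; split => [|_] //; exact: cst_continuous_fun.
Qed.

Lemma circle_valued_neq0 (g : X -> C) x : circle_valued g -> g x != 0.
Proof. by move=> [_ /(_ x) g1]; rewrite -normr_eq0 g1 oner_eq0. Qed.

Lemma quasi_eigenS m (g : X -> C) : quasi_eigen m g -> quasi_eigen m.+1 g.
Proof.
elim: m g => [|m IH] g gm; (split; first exact: quasi_eigen_circle gm).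
  case: gm => c c1 ->; exists (fun=> 1); first by exists 1 => //;
    rewrite normr1.
  by apply/funext => x /=; rewrite mul1r.
by case: gm => [_ [f fm gf]]; exists f => //; exact: IH.
Qed.

Lemma quasi_eigen_le m n (g : X -> C) : (m <= n)%N ->
  quasi_eigen m g -> quasi_eigen n g.
Proof.
move=> mn gm; rewrite -(subnKC mn); elim: (n - m)%N => [|k IH];
  first by rewrite addn0.
by rewrite addnS; exact: quasi_eigenS.
Qed.

Lemma quasi_eigenM m (g h : X -> C) : quasi_eigen m g -> quasi_eigen m h ->
  quasi_eigen m (fun x => g x * h x).
Proof.
elim: m g h => [|m IH] g h.
  by move=> [c c1 ->] [d d1 ->]; exists (c * d) => //;
    rewrite normrM c1 d1 mulr1.
move=> [[cg g1] [f fm gf]] [[ch h1] [k km hk]]; split.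
  split; first exact: mul_continuous_fun cg ch.
  by move=> x; rewrite normrM g1 h1 mulr1.
exists (fun x => f x * k x); first exact: IH.
apply/funext => x /=.
have /= -> := congr1 (@^~ x) gf; have /= -> := congr1 (@^~ x) hk.
by rewrite mulrACA.
Qed.

Lemma quasi_eigenV m (g : X -> C) : quasi_eigen m g ->
  quasi_eigen m (fun x => (g x)^-1).
Proof.
elim: m g => [|m IH] g.
  by move=> [c c1 ->]; exists c^-1 => //; rewrite normfV c1 invr1.
move=> gm; have g0 x := circle_valued_neq0 x (quasi_eigen_circle gm).
case: gm => [[cg g1] [f fm gf]]; split.
  split; first exact: inv_continuous_fun cg g0.
  by move=> x; rewrite normfV g1 invr1.
exists (fun x => (f x)^-1); first exact: IH.
by apply/funext => x /=; have /= -> := congr1 (@^~ x) gf; rewrite invfM.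
Qed.

Lemma quasi_eigen_comp m (g : X -> C) (S : X -> X) : continuous S ->
  (forall x, S (shift x) = shift (S x)) -> quasi_eigen m g ->
  quasi_eigen m (g \o S).
Proof.
move=> cS ST; elim: m g => [|m IH] g; first by move=> [c c1 ->]; exists c.
move=> [[cg g1] [f fm gf]]; split.
  split; last by move=> x; exact: g1.
  by move=> x; apply: continuous_comp; [exact: cS|exact: cg].
exists (f \o S); first exact: IH.
by apply/funext => x /=; rewrite ST; have /= -> := congr1 (@^~ (S x)) gf.
Qed.

(* A quasi-eigenfunction uniformly close to 1 has its successive quotients
   close to 1 as well, and an eigenvalue whose powers all stay near 1 is 1. *)
Lemma quasi_eigen_near1 m (g : X -> C) : minimal_sys X -> quasi_eigen m g ->
  (forall x, `|g x - 1| <= (2 ^+ m.+2)^-1) -> forall x y, g x = g y.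
Proof.
move=> mX; elim: m g => [|m IH] g; first by move=> [c _ ->].
move=> [[cg g1] [f fm gf]] gnear x y.
have fE z : g (shift z) = f z * g z by exact: (congr1 (@^~ z) gf).
(* The difference of g(s z) and g(z) is (f(z) - 1) g(z), so the distance of [f] to 1 is at most
   twice the bound for [g]; hence the tolerance halves with each level. *)
have half : (2 ^+ m.+3)^-1 + (2 ^+ m.+3)^-1 = (2 ^+ m.+2)^-1 :> C.
  have h2 : 2^-1 + 2^-1 = 1 :> C by field.
  by rewrite (exprS _ m.+2) invfM -mulrDl h2 mul1r.
have fcst z w : f z = f w.
  apply: IH => // {}z; rewrite -half.
  have -> : `|f z - 1| = `|(g (shift z) - 1) - (g z - 1)|.
    have -> : (g (shift z) - 1) - (g z - 1) = (f z - 1) * g z by rewrite fE;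
      ring.
    by rewrite normrM g1 mulr1.
  by apply: le_trans (ler_normB _ _) _; apply: lerD.
have l1 : `|f x| = 1.
  by have := g1 (shift x); rewrite fE normrM g1 mulr1.
have gn n : g (iter n (@shift X) x) = f x ^+ n * g x.
  elim: n => [|n gn]; first by rewrite mul1r.
  by rewrite iterS fE gn (fcst _ x) mulrA -exprS.
(* As [f] is constant, [g] is an eigenfunction, and its tolerance is below the 1/4 required. *)
have fx1 : f x = 1.
  apply: (eigenvalue_near1 l1 gn) => z; apply: le_trans (gnear z) _.
  rewrite lef_pV2 ?posrE ?exprn_gt0 ?ltr0n // -natrX ler_nat.
  exact: (@leq_pexp2l 2 2 m.+3).
apply: minimal_invariant_const => // z.
by rewrite fE (fcst _ x) fx1 mul1r.
Qed.

(** For [r] near 1 the quotient of g(S r x) by g(x) is a quasi-eigenfunction near 1, hence constant.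
    Every [t] is a power of such an [r], and the constants multiply along powers. *)
Lemma quasi_eigen_flow m (g : X -> C) (S : circle R -> X ->
  X) : minimal_sys X ->
  continuous (fun p : circle R * X => S p.1 p.2) ->
  (forall x, S (circle1 R) x = x) ->
  (forall s t x, S (circleM s t) x = S s (S t x)) ->
  circle_valued g ->
  (forall t, quasi_eigen m (fun x => g (S t x) / g x)) ->
  forall t, exists c, forall x, g (S t x) = c * g x.
Proof.
move=> mX cS S1 SM gc gS t.
have g0 x := circle_valued_neq0 x gc.
have e0 : 0 < (2 ^+ m.+2)^-1 :> C by rewrite invr_gt0 exprn_gt0.
have near1 := flow_near1 (@space_compact X) cS S1 gc.1 g0 e0.
have [r rnear [n rn]] := circle_root_near t near1.
have [c cr] : exists c, forall x, g (S r x) = c * g x.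
  have [[x]|X0] := pselect ([set: X] !=set0); last first.
    by exists 0 => x; case: X0; exists x.
  exists (g (S r x) / g x) => y.
  have /= -> := quasi_eigen_near1 mX (gS r) (fun x => rnear x I) x y.
  by rewrite divfK.
have : forall k s, val s = val r ^+ k -> exists c, forall x, g (S s x) = c * g
  x.
  elim=> [|k IH] s sk.
    have -> : s = (circle1 R) by exact: val_inj.
    by exists 1 => x; rewrite S1 mul1r.
  have rk1 : `|val r ^+ k| = 1 by rewrite normrX norm_val expr1n.
  have -> : s = circleM r (mkcircle rk1) by apply: val_inj; rewrite /= -exprS.
  have [|d dk] := IH (mkcircle rk1); first by [].
  by exists (c * d) => x; rewrite SM cr dk mulrA.
by move=> /(_ n t); apply; rewrite rn.
Qed.

End QuasiEigen.

Lemma uniform_closureP (R : realType) (T : topologicalType) (A : set (T -> C R))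
    (f : T -> C R) :
  closure (A : set {uniform T -> C R}) f <->
  forall e : R, 0 < e -> exists2 g, A g & forall x, cabs (f x - g x) <= e.
Proof.
split=> [clf e e0|fA B /uniform_nbhs[E [entE EB]]].
  have e0' : 0 < (e%:C)%C :> C R by rewrite ltcR.
  pose B : set {uniform T -> C R} := [set g | forall x, cabs (f x - g x) <= e].
  have [|g [Ag gB]] := clf B; last by exists g.
  apply/uniform_nbhs; exists [set xy : C R * C R | ball xy.1 (e%:C)%C xy.2].
  split; first by rewrite -entourage_ballE; exists ((e%:C)%C).
  move=> g gE x; rewrite -lecR cabsE; apply: ltW; exact: (gE x I).
move: entE; rewrite -entourage_ballE => -[e /= e0 eE].
have eR : e = ((complex.Re e)%:C)%C by rewrite RRe_real // gtr0_real.
have e0' : 0 < complex.Re e / 2 by rewrite divr_gt0 // -ltcR -eR.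
have [g Ag gP] := fA _ e0'; exists g; split => //; apply: EB => x _; apply: eE.
rewrite /= /ball /= -cabsE eR ltcR; apply: le_lt_trans (gP x) _.
by rewrite gtr_pMr ?invf_lt1 ?ltr1n //; lra.
Qed.

(** * The skew product *)

Section IrrationalPoint.
Variable R : realType.
Local Notation C := (C R).

Lemma beta_subproof : `|Complex (3 / 5) (4 / 5) : C| = 1.
Proof.
rewrite normc_def /=; have -> : (3 / 5) ^+ 2 + (4 / 5) ^+ 2 = 1 :> R by field.
by rewrite sqrtr1.
Qed.

Definition beta : circle R := mkcircle beta_subproof.

(* (3 + 4i)^n is congruent to 3 + 4i modulo 5, hence never real. *)
Lemma beta_irrational : irrational_rotation beta.
Proof.
move=> n bn.
have : exists j k : int, (5 ^+ n.+1)%:C%C * val beta ^+ n.+1 =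
    Complex (5 * j%:~R + 3) (5 * k%:~R + 4) :> C.
  elim: n {bn} => [|n [j [k jk]]].
    by exists 0, 0; rewrite !expr1 /=; simpc; congr Complex; field.
  (* The constants come from (3 + 4i)^2 = -7 + 24i with -7 = 5(-2) + 3 and 24 = 5 . 4 + 4. *)
  exists (3 * j - 4 * k - 2), (4 * j + 3 * k + 4).
  rewrite (exprS _ n.+1) (exprS (val beta)) rmorphM /= mulrACA.
  have -> : 5 %:C%C * Complex (3 / 5) (4 / 5) = Complex 3 4 :> C.
    by simpc; congr Complex; field.
  rewrite jk; simpc; congr Complex; rewrite !(rmorphD, rmorphB, rmorphM) /=;
    ring.
move=> [j [k]]; rewrite bn mulr1 => -[_ /eqP].
have -> : 5 * k%:~R + 4 = (5 * k + 4)%:~R :> R.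
  by rewrite rmorphD rmorphM.
rewrite -[0]/(0%:~R) eqr_int => /eqP; lia.
Qed.

End IrrationalPoint.

Lemma slice_continuous (Y Z : topologicalType) (f : bool * Y -> Z) :
  (forall b, continuous (fun y => f (b, y))) -> continuous f.
Proof.
move=> cf [b y] U nU.
exists ([set b], [set y' | U (f (b, y'))]) => /=.
  by split; [exact: discrete_set1|exact: (cf b y U nU)].
by move=> [b' y'] /= [-> ].
Qed.

Section System.
Variable R : realType.
Local Notation C := (C R).
Local Notation S1 := (circle R).

Definition skew_space : topologicalType := (bool * (S1 * S1))%type.

(** Two steps act on either component as a Furstenberg skew product over the rotation by beta^2: the
    fibre is multiplied by z on [false] and by beta z on [true]. *)
Definition skew_step (x : skew_space) : skew_space :=
  (~~ x.1, (circleM (beta R) x.2.1, if x.1 then x.2.2 else circleM x.2.1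
    x.2.2)).

Definition skew_stepV (x : skew_space) : skew_space :=
  (~~ x.1, (circleM (circleV (beta R)) x.2.1,
     if x.1 then circleM (circleM (beta R) (circleV x.2.1)) x.2.2 else x.2.2)).

Lemma skew_stepK : cancel skew_step skew_stepV.
Proof.
move=> [b [z w]]; rewrite /skew_step /skew_stepV /=.
have [bn0 zn0] := (val_neq0 (beta R), val_neq0 z).
congr (_, (_, _)); first by rewrite negbK.
  by apply: val_inj; rewrite [LHS]mulKf.
case: b => //=; apply: val_inj => /=.
set u := \val _ in bn0 *; set v := \val z in zn0 *; set t := \val w.
by field; rewrite bn0 zn0.
Qed.

Lemma skew_stepVK : cancel skew_stepV skew_step.
Proof.
move=> [b [z w]]; rewrite /skew_step /skew_stepV /=.
have [bn0 zn0] := (val_neq0 (beta R), val_neq0 z).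
congr (_, (_, _)); first by rewrite negbK.
  by apply: val_inj; rewrite [LHS]mulVKf.
case: b => //=; apply: val_inj => /=.
set u := \val _ in bn0 *; set v := \val z in zn0 *; set t := \val w.
by field; rewrite bn0 zn0.
Qed.

Lemma circleM_continuous_fun (T : topologicalType) (f g : T -> S1) :
  continuous f -> continuous g -> continuous (fun x => circleM (f x) (g x)).
Proof.
move=> cf cg; apply: to_circle_continuous.
apply: (@mul_continuous_fun R T (fun x => val (f x)) (fun x => val (g x))).
  by move=> x; apply: (@continuous_comp _ _ _ f val);
    [exact: cf|exact: val_continuous].
by move=> x; apply: (@continuous_comp _ _ _ g val);
  [exact: cg|exact: val_continuous].
Qed.

Lemma circleV_continuous_fun (T : topologicalType) (f : T -> S1) :
  continuous f -> continuous (fun x => circleV (f x)).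
Proof.
move=> cf; apply: to_circle_continuous.
apply: (@inv_continuous_fun R T (fun x => val (f x))).
  by move=> x; apply: (@continuous_comp _ _ _ f val);
    [exact: cf|exact: val_continuous].
by move=> x; exact: val_neq0.
Qed.

Lemma pair_continuous_fun (T U V : topologicalType) (f : T -> U) (g : T -> V) :
  continuous f -> continuous g -> continuous (fun x => (f x, g x)).
Proof. by move=> cf cg x; apply: cvg_pair; [exact: cf|exact: cg]. Qed.

Lemma fst_continuous_fun (T U : topologicalType) : continuous (@fst T U).
Proof. by move=> x; exact: cvg_fst. Qed.

Lemma snd_continuous_fun (T U : topologicalType) : continuous (@snd T U).
Proof. by move=> x; exact: cvg_snd. Qed.

Lemma skew_step_continuous : continuous skew_step.
Proof.
apply: slice_continuous => b.
apply: pair_continuous_fun; first exact: cst_continuous.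
apply: pair_continuous_fun.
  apply: circleM_continuous_fun; [exact: cst_continuous|exact:
    fst_continuous_fun].
case: b => /=; first by move=> ?; exact: cvg_snd.
apply: (@circleM_continuous_fun (S1 * S1)%type fst snd).
  exact: fst_continuous_fun.
exact: snd_continuous_fun.
Qed.

Lemma skew_stepV_continuous : continuous skew_stepV.
Proof.
apply: slice_continuous => b.
apply: pair_continuous_fun; first exact: cst_continuous.
apply: pair_continuous_fun.
  apply: circleM_continuous_fun; [exact: cst_continuous|exact:
    fst_continuous_fun].
case: b => /=; last by move=> ?; exact: cvg_snd.
apply: (@circleM_continuous_fun (S1 * S1)%type
  (fun y => circleM (beta R) (circleV y.1)) snd);
    last exact: snd_continuous_fun.
apply: (@circleM_continuous_fun (S1 * S1)%type (fun=> beta R) (fun y => circleV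
  y.1)).
  exact: cst_continuous.
by apply: (@circleV_continuous_fun (S1 * S1)%type fst);
  exact: fst_continuous_fun.
Qed.

Lemma skew_space_compact : compact [set: skew_space].
Proof.
have -> : [set: skew_space] = [set: bool] `*` ([set: S1] `*` [set: S1]).
  by apply/seteqP; split => -[b [z w]].
apply: compact_setX; first exact/finite_compact/finite_finset.
by apply: compact_setX; exact: circle_compact.
Qed.

Lemma hausdorff_prod (T U : topologicalType) :
  hausdorff_space T -> hausdorff_space U -> hausdorff_space (T * U)%type.
Proof.
move=> hT hU [a b] [c d] cl; congr (_, _).
  apply: hT => A B nA nB.
  have [||[x y] [[Ax _] [Bx _]]] := cl (A `*` setT) (B `*` setT).
  - by exists (A, setT) => //; split => //; exact: filterT.
  - by exists (B, setT) => //; split => //; exact: filterT.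
  by exists x.
apply: hU => A B nA nB.
have [||[x y] [[_ Ay] [_ By]]] := cl (setT `*` A) (setT `*` B).
- by exists (setT, A) => //; split => //; exact: filterT.
- by exists (setT, B) => //; split => //; exact: filterT.
by exists y.
Qed.

Lemma skew_space_hausdorff : hausdorff_space skew_space.
Proof.
apply: hausdorff_prod; first exact: discrete_hausdorff.
by apply: hausdorff_prod; exact: circle_hausdorff.
Qed.

Definition skew_sys : dynSys := DynSys skew_stepK skew_stepVK
  skew_step_continuous skew_stepV_continuous
  skew_space_compact skew_space_hausdorff.

(** These rotations commute with the step, so the circle acts by automorphisms. Minimality,
    distality and the rigidity of quasi-eigenfunctions all use this action. *)
Definition fibre_rot (t : S1) (x : skew_space) : skew_space :=
  (x.1, (x.2.1, circleM t x.2.2)).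

Lemma fibre_rot_flow_continuous : continuous (fun p : S1 * skew_space =>
  fibre_rot p.1 p.2).
Proof.
have c1 : continuous (fun p : S1 * skew_space => p.2.1).
  move=> p; apply: (@continuous_comp _ _ _ (@snd S1 skew_space) fst);
    exact: cvg_snd || exact: cvg_fst.
have c2 : continuous (fun p : S1 * skew_space => p.2.2).
  move=> p; apply: (@continuous_comp _ _ _ (@snd S1 skew_space) snd);
    exact: cvg_snd.
have c21 : continuous (fun p : S1 * skew_space => p.2.2.1).
  by move=> p; apply: (@continuous_comp _ _ _ _ fst _ (c2 p)); exact: cvg_fst.
have c22 : continuous (fun p : S1 * skew_space => p.2.2.2).
  by move=> p; apply: (@continuous_comp _ _ _ _ snd _ (c2 p)); exact: cvg_snd.
apply: (pair_continuous_fun c1); apply: (pair_continuous_fun c21).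
apply: (@circleM_continuous_fun (S1 * skew_space)%type fst (fun p => p.2.2.2))
  c22.
exact: fst_continuous_fun.
Qed.

Lemma fibre_rot_continuous t : continuous (fibre_rot t).
Proof.
move=> x; apply: (@continuous_comp _ _ _ (fun x : skew_space => (t, x))
  (fun p : S1 * skew_space => fibre_rot p.1 p.2));
    last exact: fibre_rot_flow_continuous.
by apply: pair_continuous_fun; [exact: cst_continuous|move=> ?; exact: cvg_id].
Qed.

Lemma circleMA (s t u : S1) : circleM s (circleM t u) = circleM (circleM s t) u.
Proof. by apply: val_inj; rewrite /= mulrA. Qed.

Lemma circleMC (s t : S1) : circleM s t = circleM t s.
Proof. by apply: val_inj; rewrite /= mulrC. Qed.

Lemma circle1M (s : S1) : circleM (circle1 R) s = s.
Proof. by apply: val_inj; rewrite /= mul1r. Qed.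

Lemma circle_divK (s t : S1) : circleM (circleM t (circleV s)) s = t.
Proof. by apply: val_inj; rewrite /= divfK // val_neq0. Qed.

Lemma fibre_rotM s t x : fibre_rot (circleM s t) x = fibre_rot s (fibre_rot t
  x).
Proof. by rewrite /fibre_rot /= circleMA. Qed.

Lemma fibre_rot1 x : fibre_rot (circle1 R) x = x.
Proof. by case: x => b [z w]; rewrite /fibre_rot /= circle1M. Qed.

Lemma fibre_rot_step t x : fibre_rot t (skew_step x) = skew_step (fibre_rot t
  x).
Proof.
case: x => -[] [z w]; rewrite /fibre_rot /skew_step //=; congr (_, (_, _)).
by rewrite !circleMA (circleMC t).
Qed.

Lemma fibre_rot_stepV t x : fibre_rot t (skew_stepV x) = skew_stepV (fibre_rot t
  x).
Proof. by rewrite -{2}(skew_stepVK x) fibre_rot_step skew_stepK. Qed.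

End System.

(** * Minimality and distality *)

Section Minimality.
Variable R : realType.
Local Notation C := (C R).
Local Notation S1 := (circle R).
Local Notation X := (skew_sys R).

Definition base (x : X) : S1 := x.2.1.
Definition fibre (x : X) : S1 := x.2.2.

Lemma base_continuous : continuous base.
Proof.
move=> x; apply: (@continuous_comp _ _ _ (@snd bool (S1 * S1)) fst).
  exact: cvg_snd.
exact: cvg_fst.
Qed.

Lemma fibre_continuous : continuous fibre.
Proof.
move=> x; apply: (@continuous_comp _ _ _ (@snd bool (S1 * S1)) snd).
  exact: cvg_snd.
exact: cvg_snd.
Qed.

Lemma closed_component b : closed [set x : X | x.1 = b].
Proof.
have -> : [set x : X | x.1 = b] = fst @^-1` [set b] by [].
apply: (@closed_comp X bool) => [x _|]; first exact: cvg_fst.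
exact: (compact_closed discrete_hausdorff (@compact_set1 bool b)).
Qed.

Lemma base_closed (M : set X) : closed M -> closed (base @` M).
Proof.
move=> cM; apply: compact_closed; first exact: circle_hausdorff.
apply: continuous_compact.
  by apply: continuous_subspaceT; exact: base_continuous.
exact: (subclosed_compact cM (@space_compact X)).
Qed.

Lemma beta2_irrational : irrational_rotation (circleM (beta R) (beta R)).
Proof.
move=> n; rewrite /= -expr2 -exprM mulnSr addn2; exact: beta_irrational.
Qed.

Lemma fibre_rot_invariant (M : set X) t :
  invariant_set M -> invariant_set (fibre_rot t @^-1` M : set X).
Proof.
by move=> [MS MV]; split => x /= Mx;
  [rewrite /shift /= fibre_rot_step; exact: MS|rewrite /shiftV /=
    fibre_rot_stepV; exact: MV].
Qed.

Section MinimalSet.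
Variable M : set X.
Hypotheses (cM : closed M) (M0 : M !=set0) (MI : invariant_set M).
Hypothesis Mmin : forall N, closed N -> N !=set0 -> invariant_set N ->
  N `<=` M -> N = M.

(** The base points of [M] over one component form a closed set invariant under the rotation by
    beta^2, which has infinite order. *)
Lemma minimal_set_base b z : exists w, M (b, (z, w)).
Proof.
pose A := base @` (M `&` [set x : X | x.1 = b]).
have flip : forall x, M x -> M (skew_step x) by exact: MI.1.
have flipV : forall x, M x -> M (skew_stepV x) by exact: MI.2.
have AT : A = setT.
  apply: (irrational_rotation_closed beta2_irrational).
  - apply: base_closed; apply: closedI cM _; exact: closed_component.
  - have [x Mx] := M0; have [xb|xb] := pselect (x.1 = b).
      by exists (base x), x.
    exists (base (skew_step x)), (skew_step x) => //; split; first exact: flip.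
    by move/eqP: xb => /=; case: (x.1); case: (b).
  - move=> _ [x [Mx xb] <-]; exists (skew_step (skew_step x)); last first.
      by rewrite /base /= circleMA.
    by split; [exact/flip/flip|rewrite /= negbK].
  - move=> _ [x [Mx xb] <-]; exists (skew_stepV (skew_stepV x)); last first.
      by apply: val_inj; rewrite /base /= invfM mulrA.
    by split; [exact/flipV/flipV|rewrite /= negbK].
have : A z by rewrite AT.
by move=> [[b' [z' w]] [Mx /= <-] <-]; exists w.
Qed.

(** [M] intersected with its preimage under the rotation is again closed, invariant and nonempty, so
    minimality makes it equal to [M]. *)
Lemma minimal_set_fibre_rot t x : M x -> M (fibre_rot t x) -> forall y, M y ->
  M (fibre_rot t y).
Proof.
move=> Mx Mtx y My.
suff E : M `&` (fibre_rot t @^-1` M) = M by have [] : (M `&` (fibre_rot t @^-1`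
  M)) y by rewrite E.
apply: Mmin.
- apply: closedI => //; apply: closed_comp => // ? _;
  exact: fibre_rot_continuous.
- by exists x.
- have [I1 I2] := fibre_rot_invariant t MI.
  by split => z [Mz Mtz]; split; [exact: MI.1|exact: I1|exact: MI.2|exact: I2].
- exact: subIsetl.
Qed.

Let H : set S1 := [set t | forall y, M y -> M (fibre_rot t y) /\ M (fibre_rot
  (circleV t) y)].

Let HP t x : M x -> M (fibre_rot t x) -> H t.
Proof.
move=> Mx Mtx y My; split; first exact: minimal_set_fibre_rot Mx Mtx _ My.
apply: minimal_set_fibre_rot Mtx _ _ My.
by rewrite -fibre_rotM (_ : circleM _ _ = circle1 R) ?fibre_rot1 //;
  apply: val_inj; rewrite /= mulVf // val_neq0.
Qed.

Let H_closed : closed H.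
Proof.
have [x Mx] := M0.
have -> : H = (fun t => fibre_rot t x) @^-1` M.
  by apply/seteqP; split => t /= Ht; [exact: (Ht x Mx).1|exact: HP Mx Ht].
apply: closed_comp => // t _.
apply: (@continuous_comp _ _ _ (fun t : S1 => (t, x : skew_space R))
  (fun p : S1 * skew_space R => fibre_rot p.1 p.2));
    last exact: fibre_rot_flow_continuous.
by apply: pair_continuous_fun; [move=> ?; exact: cvg_id|exact: cst_continuous].
Qed.

(* If the fibres of M are cosets of a finite group, the N-th power of the fibre
   coordinate is a continuous function of the base point, and it multiplies by
   z^N under a rotation by beta^2: moving the base point by a small t, this
   forces t^N = 1. *)
Let no_torsion n : ~ forall t, H t -> val t ^+ n.+1 = 1.
Proof.
move=> Htor.
have [ws wsP] := choice (minimal_set_base false).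
(* Two points of [M] over the same base point differ by an element of [H], which the power kills. *)
have uniq z w : M (false, (z, w)) -> val w ^+ n.+1 = val (ws z) ^+ n.+1.
  move=> Mw; have : H (circleM w (circleV (ws z))).
    by apply: HP (wsP z) _; rewrite /fibre_rot /= circle_divK.
  move=> /Htor /=; rewrite exprMn exprVn => /divr1_eq.
  by [].
pose g z := val (ws z) ^+ n.+1.
(* Closed graph argument: the preimage of a closed set is the projection of a closed subset of a
   compact space. *)
have cg : continuous (g : S1 -> C).
  apply/continuous_closedP => D cD.
  have -> : g @^-1` D = base @` (M `&` [set x : X | x.1 = false] `&`
      [set x : X | D (val (fibre x) ^+ n.+1)]).
    apply/seteqP; split => [z Dz|_ [[b [z w]] [[Mx /= bf] Dx] <-]].
      by exists (false, (z, ws z)).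
    by rewrite /base /= /g -(uniq z w) // -bf.
  apply: base_closed; apply: closedI.
    by apply: closedI cM _; exact: closed_component.
  apply: closed_comp cD => x _.
  apply: (@exp_continuous_fun R X (fun x => val (fibre x))) => {}x.
  by apply: (@continuous_comp _ _ _ fibre val);
    [exact: fibre_continuous|exact: val_continuous].
have g1 z : `|g z| = 1 by rewrite normrX norm_val expr1n.
have g0 z : g z != 0 by rewrite -normr_eq0 g1 oner_eq0.
pose b2 := circleM (beta R) (beta R).
have gb z : g (circleM b2 z) = val z ^+ n.+1 * g z.
  rewrite -exprMn; symmetry; apply: (uniq _ (circleM z (ws z))).
  have := MI.1 _ (MI.1 _ (wsP z)); rewrite /shift /= /skew_step /=.
  by rewrite -/b2 circleMA.
have e0 : 0 < 4^-1 :> C by rewrite invr_gt0.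
have cS : continuous (fun p : S1 * S1 => circleM p.1 p.2).
  by apply: circleM_continuous_fun; move=> ?; [exact: cvg_fst|exact: cvg_snd].
have near1 := flow_near1 (@circle_compact R) cS (@circle1M R) cg g0 e0.
(* The quotient of g(tz) by g(z) is an eigenfunction of the rotation by beta^2, with eigenvalue t^N
   for N = [n.+1]; being close to 1, it forces t^N = 1. *)
have tor t : (forall z, `|g (circleM t z) / g z - 1| <= 4^-1) ->
  val t ^+ n.+1 = 1.
  move=> tnear.
  apply: (@eigenvalue_near1 R S1 (circleM b2) (fun z => g (circleM t z) / g z) _
    (circle1 R)) => //.
    by rewrite normrX norm_val expr1n.
  elim=> [|k IH]; first by rewrite mul1r.
  rewrite iterS; move: IH; set z := iter k _ _ => IH.
  rewrite [in RHS]exprS -[RHS]mulrA -IH circleMA (circleMC t) -circleMA !gb /=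
    exprMn.
  have z0 : val z ^+ n.+1 != 0 by rewrite expf_neq0 // val_neq0.
  have := g0 z; set u := g z; set v := g _; set q := val z ^+ n.+1 in z0 *.
  by move=> u0; field; rewrite u0 z0.
(* A root [r] of beta near 1 satisfies r^N = 1, so beta would have finite order. *)
have [r rnear [k rk]] := circle_root_near (beta R) near1.
apply: (@beta_irrational R n); rewrite -rk exprAC tor ?expr1n //.
by move=> z; exact: rnear.
Qed.

Lemma minimal_set_full : M = setT.
Proof.
have [|||HT|[n Hn]] := @closed_subgroup_circle R H H_closed.
- by move=> y My; rewrite (_ : circleV (circle1 R) = circle1 R) ?fibre_rot1 //;
    apply: val_inj; rewrite /= invr1.
- move=> u v Hu Hv; have [x Mx] := M0; apply: (HP Mx).
  by rewrite fibre_rotM; apply: (Hu _ _).1; apply: (Hv _ _).1.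
- by move=> u Hu; have [x Mx] := M0; apply: (HP Mx); exact: (Hu _ _).2.
- apply/seteqP; split => // -[b [z w]] _.
  have [w0 Mw0] := minimal_set_base b z.
  have : H (circleM w (circleV w0)) by rewrite HT.
  by move=> /(_ _ Mw0)[+ _]; rewrite /fibre_rot /= circle_divK.
- by case: (no_torsion Hn).
Qed.

End MinimalSet.

Theorem skew_sys_minimal : minimal_sys X.
Proof. by apply: minimal_sys_of_minimal_sets => M; exact: minimal_set_full. Qed.

Definition comp_sgn (x : X) : C := if x.1 then -1 else 1.
Definition base_coord (x : X) : C := val (base x).
Definition fibre_coord (x : X) : C := val (fibre x).

Lemma comp_sgn_continuous : continuous comp_sgn.
Proof. by apply: slice_continuous => b; exact: cst_continuous_fun. Qed.

Lemma base_coord_continuous : continuous base_coord.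
Proof.
by move=> x; apply: (@continuous_comp _ _ _ base val);
  [exact: base_continuous|exact: val_continuous].
Qed.

Lemma fibre_coord_continuous : continuous fibre_coord.
Proof.
by move=> x; apply: (@continuous_comp _ _ _ fibre val);
  [exact: fibre_continuous|exact: val_continuous].
Qed.

Lemma comp_sgn_inj x y : comp_sgn x = comp_sgn y -> x.1 = y.1.
Proof.
have n1 : (-1 : C) <> 1.
  by apply/eqP; rewrite eq_sym -subr_eq0 opprK -[1]/(1%:R) -natrD pnatr_eq0.
by case: x y => [[] ?] [[] ?] // E; case: n1; (exact: E || exact: (esym E)).
Qed.

Lemma coord_inj x y : comp_sgn x = comp_sgn y -> base_coord x = base_coord y ->
  fibre_coord x = fibre_coord y -> x = y.
Proof.
case: x y => [b [z w]] [b' [z' w']] /comp_sgn_inj /= ->.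
by rewrite /base_coord /fibre_coord /base /fibre /= => /val_inj -> /val_inj ->.
Qed.

Lemma eval_continuous (g : X -> C) (x : X) : continuous g ->
  continuous (fun a : {ptws X -> X} => g (a x)).
Proof.
move=> cg a; apply: (@continuous_comp {ptws X -> X} X C (fun f => f x) g);
  last exact: cg.
exact: (@proj_continuous X (fun=> X) x a).
Qed.

(** The locus where [F] and [G] agree is closed and contains all powers of the homeomorphism;
    identities pass to E(X) in this way. *)
Lemma ellis_eq_fun (F G : {ptws X -> X} -> C) : continuous F -> continuous G ->
  (forall n, F (@shiftz X n) = G (@shiftz X n)) ->
  forall a, ellis a -> F a = G a.
Proof.
move=> cF cG FG a Ea.
have : closed [set b | F b = G b] by exact: (closed_eq_fun cF cG).
apply => B nB; have [_ [[n _ <-] Bn]] := Ea B nB.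
by exists (@shiftz X n); split.
Qed.

(** Powers of s commute with [S], and this survives pointwise limits because [S] is continuous.
    Equality in [X] is tested on the three coordinate functions. *)
Lemma ellis_commute (S : X -> X) (a : X -> X) : continuous S ->
  (forall x, S (shift x) = shift (S x)) -> ellis a ->
    forall x, a (S x) = S (a x).
Proof.
move=> cS ST Ea x.
have STV y : S (shiftV y) = shiftV (S y) by rewrite -{2}(shiftVK y) ST shiftK.
have Sz n y : @shiftz X n (S y) = S (shiftz n y).
  have itS k : iter k (@shift X) (S y) = S (iter k (@shift X) y).
    by elim: k => //= k ->; rewrite ST.
  have itV k : iter k (@shiftV X) (S y) = S (iter k (@shiftV X) y).
    by elim: k => //= k ->; rewrite STV.
  by case: n => n; [exact: itS|exact: itV].
have E (g : X -> C) : continuous g -> g (a (S x)) = g (S (a x)).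
  move=> cg; apply: (@ellis_eq_fun (fun a => g (a (S x))) (fun a => g (S (a
    x)))) => //.
  - exact: eval_continuous.
  - apply: (@eval_continuous (g \o S)) => y.
    by apply: continuous_comp; [exact: cS|exact: cg].
  - by move=> n /=; rewrite Sz.
apply: coord_inj; apply: E.
- exact: comp_sgn_continuous.
- exact: base_coord_continuous.
- exact: fibre_coord_continuous.
Qed.

(** A power of s multiplies an eigenfunction by a factor independent of the point. The
    cross-multiplied form avoids naming that factor and therefore passes to limits. *)
Lemma comp_sgn_shiftz n x y : comp_sgn (@shiftz X n x) * comp_sgn y = comp_sgn
  (@shiftz X n y) * comp_sgn x.
Proof.
have sS z : comp_sgn (shift z) = - comp_sgn z by case: z => -[] [? ?];
  rewrite /comp_sgn /= ?opprK.
have sV z : comp_sgn (shiftV z) = - comp_sgn z by case: z => -[] [? ?];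
  rewrite /comp_sgn /= ?opprK.
have itS k z : comp_sgn (iter k (@shift X) z) = (-1) ^+ k * comp_sgn z.
  by elim: k => [|k IH] /=; rewrite ?mul1r // sS IH exprS mulN1r mulNr.
have itV k z : comp_sgn (iter k (@shiftV X) z) = (-1) ^+ k * comp_sgn z.
  by elim: k => [|k IH] /=; rewrite ?mul1r // sV IH exprS mulN1r mulNr.
by case: n => n; rewrite /shiftz ?itS ?itV -!mulrA (mulrC (comp_sgn x)).
Qed.

Lemma base_coord_shiftz n x y :
  base_coord (@shiftz X n x) * base_coord y =
  base_coord (@shiftz X n y) * base_coord x.
Proof.
have sS z : base_coord (shift z) = val (beta R) * base_coord z by [].
have sV z : base_coord (shiftV z) = (val (beta R))^-1 * base_coord z by [].
have itS k z : base_coord (iter k (@shift X) z) = val (beta R) ^+ k * base_coord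
  z.
  by elim: k => [|k IH]; rewrite ?mul1r // iterS sS IH exprS mulrA.
have itV k z : base_coord (iter k (@shiftV X) z) = (val (beta R))^-1 ^+ k *
  base_coord z.
  by elim: k => [|k IH]; rewrite ?mul1r // iterS sV IH exprS mulrA.
by case: n => n; rewrite /shiftz ?itS ?itV -!mulrA (mulrC (base_coord x)).
Qed.

Lemma ellis_comp_sgn a x y : ellis a -> comp_sgn (a x) * comp_sgn y = comp_sgn
  (a y) * comp_sgn x.
Proof.
move=> Ea; apply: (@ellis_eq_fun (fun a => comp_sgn (a x) * comp_sgn y) (fun a
  => comp_sgn (a y) * comp_sgn x)) => //.
- apply: (mul_continuous_fun (f := fun a : {ptws X -> X} => comp_sgn (a x))).
    exact: eval_continuous comp_sgn_continuous.
  exact: cst_continuous_fun.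
- apply: (mul_continuous_fun (f := fun a : {ptws X -> X} => comp_sgn (a y))).
    exact: eval_continuous comp_sgn_continuous.
  exact: cst_continuous_fun.
- by move=> n; exact: comp_sgn_shiftz.
Qed.

Lemma ellis_base_coord a x y : ellis a ->
  base_coord (a x) * base_coord y = base_coord (a y) * base_coord x.
Proof.
move=> Ea; apply: (@ellis_eq_fun (fun a => base_coord (a x) * base_coord y) (fun
  a => base_coord (a y) * base_coord x)) => //.
- apply: (mul_continuous_fun (f := fun a : {ptws X -> X} => base_coord (a x))).
    exact: eval_continuous base_coord_continuous.
  exact: cst_continuous_fun.
- apply: (mul_continuous_fun (f := fun a : {ptws X -> X} => base_coord (a y))).
    exact: eval_continuous base_coord_continuous.
  exact: cst_continuous_fun.
- by move=> n; exact: base_coord_shiftz.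
Qed.

Lemma comp_sgn_neq0 x : comp_sgn x != 0.
Proof. by rewrite /comp_sgn; case: ifP => _; rewrite ?oppr_eq0 oner_eq0. Qed.

(** If a(x) = a(y), the two eigenfunctions put [x] and [y] into the same fibre. They then differ by
    a fibre rotation, which commutes with [a] and must be trivial. *)
Theorem skew_sys_distal : distal_sys X.
Proof.
move=> a Ea x y axy.
have sxy : comp_sgn x = comp_sgn y.
  have := ellis_comp_sgn x y Ea; rewrite axy => /(mulfI (comp_sgn_neq0 _)) ->.
  by [].
have zxy : base_coord x = base_coord y.
  by have := ellis_base_coord x y Ea; rewrite axy => /(mulfI (val_neq0 _)) ->.
pose t := circleM (fibre x) (circleV (fibre y)).
have xt : x = fibre_rot t y.
  by apply: coord_inj; rewrite // /fibre_coord /fibre /= divfK // val_neq0.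
apply: coord_inj => //.
have : a x = fibre_rot t (a y).
  rewrite {1}xt; apply: (ellis_commute (S := fibre_rot t)) => //.
    exact: fibre_rot_continuous.
  exact: fibre_rot_step.
rewrite axy => /(congr1 fibre_coord); rewrite /fibre_coord /fibre /= -[LHS]mul1r
  => /(mulIf (val_neq0 _)).
by move=> /esym/divr1_eq.
Qed.

End Minimality.

(** * Quasi-eigenfunctions of the skew product *)

Section NotQuasiDiscrete.
Variable R : realType.
Local Notation C := (C R).
Local Notation S1 := (circle R).
Local Notation X := (skew_sys R).

Definition base_rot (t : S1) (x : X) : X := (x.1, (circleM t (base x), fibre
  x)).

Lemma base_rot_flow_continuous : continuous (fun p : S1 * X => base_rot p.1
  p.2).
Proof.
have cs : continuous (@snd S1 X) by move=> p; exact: cvg_snd.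
have c1 : continuous (fun p : S1 * X => p.2.1).
  by move=> p; apply: (@continuous_comp _ _ _ _ fst _ (cs p)); exact: cvg_fst.
have c21 : continuous (fun p : S1 * X => base p.2).
  by move=> p; apply: (@continuous_comp (S1 * X)%type X S1 snd (@base R) p (cs
    p)); exact: base_continuous.
have c22 : continuous (fun p : S1 * X => fibre p.2).
  by move=> p; apply: (@continuous_comp (S1 * X)%type X S1 snd (@fibre R) p (cs
    p)); exact: fibre_continuous.
apply: (pair_continuous_fun c1).
apply: (@pair_continuous_fun _ _ _ (fun p : S1 * X => circleM p.1 (base p.2)))
  c22.
apply: (@circleM_continuous_fun _ (S1 * X)%type fst (fun p => base p.2)) c21.
exact: fst_continuous_fun.
Qed.

Lemma base_rot_continuous t : continuous (base_rot t).
Proof.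
move=> x; apply: (@continuous_comp _ _ _ (fun x : X => (t, x))
  (fun p : S1 * X => base_rot p.1 p.2)); last exact: base_rot_flow_continuous.
by apply: pair_continuous_fun; [exact: cst_continuous|move=> ?; exact: cvg_id].
Qed.

(** A fibre rotation commutes with the step, so the quotient of the rotated [g] by [g] is a
    quasi-eigenfunction of the same level. *)
Lemma fibre_rot_quasi_eigen m (g : X -> C) : quasi_eigen m g ->
  forall t, exists c, forall x, g (fibre_rot t x) = c * g x.
Proof.
move=> gm; apply: (@quasi_eigen_flow R X m g (@fibre_rot R)) => //.
- exact: skew_sys_minimal.
- exact: fibre_rot_flow_continuous.
- exact: fibre_rot1.
- exact: fibre_rotM.
- exact: quasi_eigen_circle gm.
- move=> t; apply: (@quasi_eigenM R X m (g \o @fibre_rot R t) (fun x => (g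
  x)^-1)); last exact: quasi_eigenV.
  by apply: quasi_eigen_comp gm; [exact: fibre_rot_continuous|exact:
    fibre_rot_step].
Qed.

(** A base rotation fails to commute with the step only by a fibre rotation on the component
    [false]; functions constant along fibres do not see the failure. *)
Lemma base_rot_step t (x : X) :
  shift (base_rot t x) = fibre_rot (if x.1 then circle1 R else t) (base_rot t
    (shift x)) :> X.
Proof.
case: x => b [z w]; rewrite /base_rot /= /fibre_rot /skew_step /base /fibre /=.
congr (_, (_, _)); first by rewrite !circleMA (circleMC t).
by case: b; rewrite ?circle1M // circleMA.
Qed.

(** The quotient [h] belonging to a fibre-invariant [f] is fibre-invariant too, so the induction
    goes through by [base_rot_step]. *)
Lemma base_rot_quasi_eigen m (f : X -> C) t : quasi_eigen m f ->
  (forall s x, f (fibre_rot s x) = f x) -> quasi_eigen m (f \o base_rot t).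
Proof.
elim: m f => [|m IH] f; first by move=> [c c1 ->] _; exists c.
move=> fm fv; have f0 x := circle_valued_neq0 x (quasi_eigen_circle fm).
move: fm => [[cf f1] [h hm fh]].
have hE x : f (shift x) = h x * f x by exact: (congr1 (@^~ x) fh).
split.
  split; last by move=> x; exact: f1.
  by move=> x; apply: continuous_comp; [exact: base_rot_continuous|exact: cf].
exists (h \o base_rot t).
  apply: IH => // s x; apply: (mulIf (f0 (fibre_rot s x))).
  by rewrite -hE fv -hE /shift /= -fibre_rot_step fv.
by apply/funext => x /=; rewrite -hE base_rot_step fv.
Qed.

Lemma circleN1_subproof : `|-1 : C| = 1.
Proof. by rewrite normrN normr1. Qed.

Definition circleN1 : S1 := mkcircle circleN1_subproof.

Lemma fibre_rotN1_quasi_eigen m (g : X -> C) : quasi_eigen m g ->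
  forall x, g (fibre_rot circleN1 x) = g x.
Proof.
case: m => [[c _ ->] //|m] gm.
have [c cP] := choice (fibre_rot_quasi_eigen gm).
have gc := quasi_eigen_circle gm.
have g0 x := circle_valued_neq0 x gc.
move: gm => [_ [f fm gf]].
have fE x : g (shift x) = f x * g x by exact: (congr1 (@^~ x) gf).
have f0 x := circle_valued_neq0 x (quasi_eigen_circle fm).
have c0 t : c t != 0.
  apply: contraNneq (g0 (fibre_rot t (true, (circle1 R, circle1 R)))) => ct.
  by rewrite cP ct mul0r.
(* The multiplier [c s] cancels in the quotient of g(s x) by g(x). *)
have fv s x : f (fibre_rot s x) = f x.
  apply: (mulIf (g0 (fibre_rot s x))); rewrite -fE /shift /= -fibre_rot_step
    !cP.
  by rewrite [g (skew_step x)]fE mulrCA.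
have fb t : exists d, forall x, f (base_rot t x) = d * f x.
  apply: (@quasi_eigen_flow R X m f base_rot) => //.
  - exact: skew_sys_minimal.
  - exact: base_rot_flow_continuous.
  - by move=> [b [z w]]; rewrite /base_rot /base /fibre /= circle1M.
  - by move=> s u [b [z w]]; rewrite /base_rot /base /fibre /= circleMA.
  - exact: quasi_eigen_circle fm.
  - move=> s; apply: (@quasi_eigenM R X m (f \o base_rot s) (fun x => (f
    x)^-1)); last exact: quasi_eigenV.
    exact: base_rot_quasi_eigen.
pose p b z : X := (b, (z, circle1 R)).
(* A base rotation multiplies [f] by the same constant on both components, so it cancels in
   [rho]. *)
pose rho z := f (p false z) / f (p true z).
have rhoC z : rho z = rho (circle1 R).
  have [d dP] := fb z; have d0 : d != 0.
    apply: contraNneq (f0 (base_rot z (p true (circle1 R)))) => dz.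
    by rewrite dP dz mul0r.
  have -> : rho z = f (base_rot z (p false (circle1 R))) / f (base_rot z (p true
    (circle1 R))).
    by rewrite /rho /base_rot /p /base /fibre /= circleMC circle1M.
  by rewrite !dP /rho -mulf_div divff // mul1r.
pose F z := g (p true z) / g (p false z).
have F0 z : F z != 0 by rewrite mulf_neq0 ?invr_eq0.
(* The step sends (0, z, 1) to (1, beta z, z), where [c z] enters, and (1, z, 1) to (0, beta z, 1);
   dividing the two values of [f] gives the identity. *)
have key z : c z * F z * F (circleM (beta R) z) = rho (circle1 R).
  have e1 : f (p false z) = c z * g (p true (circleM (beta R) z)) / g (p false
    z).
    apply: (mulIf (g0 (p false z))); rewrite -fE divfK // -cP.
    by congr g; rewrite /fibre_rot /p /shift /= /skew_step /=.
  have e2 : f (p true z) = g (p false (circleM (beta R) z)) / g (p true z).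
    apply: (mulIf (g0 (p true z))); rewrite -fE divfK //.
  rewrite -(rhoC z) /rho e1 e2 /F.
  have n1 := g0 (p false z); have n2 := g0 (p true z).
  have n3 := g0 (p false (circleM (beta R) z)).
  by field; rewrite n1 n2 n3.
have cM s t : c (circleM s t) = c s * c t.
  apply: (mulIf (g0 (p true (circle1 R)))).
  by rewrite -cP fibre_rotM !cP mulrA.
pose h z := F (circleM circleN1 z) / F z.
pose b2 := circleM (beta R) (beta R).
(* The identities [key] at z and at beta z share the constant and the factor F(beta z). *)
have Fb z : F z = c (beta R) * F (circleM b2 z).
  have := key (circleM (beta R) z); rewrite -(key z) cM circleMA -/b2 => E.
  apply: (mulfI (c0 z)); apply: (mulIf (F0 (circleM (beta R) z))); rewrite -E.
  by ring.
(* The factor c(beta) cancels in [h], which is thus invariant under an irrational rotation and hence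
   constant. *)
have hb z : h (circleM b2 z) = h z.
  have E : circleM circleN1 (circleM b2 z) = circleM b2 (circleM circleN1 z).
    by rewrite circleMA (circleMC circleN1) -circleMA.
  by rewrite /h E (Fb z) (Fb (circleM circleN1 z)) -[RHS]mulf_div divff //
    mul1r.
have cp b : continuous (fun z => g (p b z)).
  move=> z; apply: (@continuous_comp _ _ _ (p b) g); last exact: gc.1.
  apply: (pair_continuous_fun (@cst_continuous S1 bool b)).
  by apply: pair_continuous_fun; [move=> ?; exact: cvg_id|exact:
    cst_continuous].
have cF : continuous F.
  apply: (mul_continuous_fun (cp true)).
  by apply: (inv_continuous_fun (cp false)) => z; exact: g0.
have ch : continuous h.
  apply: (@mul_continuous_fun R S1 (fun z => F (circleM circleN1 z)) (fun z =>
    (F z)^-1)).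
    move=> z; apply: (@continuous_comp _ _ _ (circleM circleN1) F);
      last exact: cF.
    apply: (@circleM_continuous_fun R S1 (fun=> circleN1) id) => //.
      exact: cst_continuous.
    by move=> ?; exact: cvg_id.
  exact: inv_continuous_fun cF F0.
have hC z : h z = h (circle1 R).
  suff : [set z | h z = h (circle1 R)] = setT by move/seteqP => -[_ /(_ z I)].
  apply: (irrational_rotation_closed (@beta2_irrational R)).
  - exact: (@closed_eq_fun S1 R h (fun=> h (circle1 R)) ch (@cst_continuous_fun
    R S1 _)).
  - by exists (circle1 R).
  - by move=> w /= hw; rewrite hb.
  - move=> w /= hw; rewrite -hw -(hb (circleM _ w)) -/b2; congr h.
    by apply: val_inj; rewrite [LHS]mulVKf // (val_neq0 b2).
have h2 : h (circle1 R) * h (circle1 R) = 1.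
  rewrite -{1}(hC circleN1) /h.
  have -> : circleM circleN1 circleN1 = circle1 R by apply: val_inj;
    rewrite /= mulrNN mulr1.
  rewrite (circleMC _ (circle1 R)) circle1M.
  move: (F0 (circle1 R)) (F0 circleN1); move: (F (circle1 R)) (F circleN1) => u
    v u0 v0.
  by field; rewrite u0 v0.
(* From 1 to -1 both factors [F] in [key] change by the constant [h], whose square is 1, so c(-1) =
   c(1). *)
have c1 : c circleN1 = 1.
  have := key circleN1; rewrite -(key (circle1 R)).
  have -> : F circleN1 = h (circle1 R) * F (circle1 R).
    by rewrite /h divfK // (circleMC _ (circle1 R)) circle1M.
  have -> : F (circleM (beta R) circleN1) = h (circle1 R) * F (circleM (beta R)
    (circle1 R)).
    by rewrite (circleMC _ circleN1) (circleMC _ (circle1 R)) circle1M -(hC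
      (beta R)) /h divfK.
  have -> : c (circle1 R) = 1.
    apply: (mulIf (g0 (p true (circle1 R)))); by rewrite -cP fibre_rot1 mul1r.
  rewrite mul1r => E.
  apply: (mulIf (F0 (circle1 R))); apply: (mulIf (F0 (circleM (beta R) (circle1
    R)))).
  by rewrite mul1r -E -[LHS]mul1r -h2; ring.
by move=> x; rewrite cP c1 mul1r.
Qed.

(** Functions in the span agree at [x] and at its fibre rotation by -1, whereas [fibre_coord] takes
    the values 1 and -1 there; an approximation within 1/2 would give 2 <= 1. *)
Theorem skew_sys_not_quasi_discrete : ~ quasi_discrete_spectrum R X.
Proof.
move=> /(_ (@fibre_coord R) (@fibre_coord_continuous R)) /uniform_closureP.
have e0 : 0 < 2^-1 :> R by rewrite invr_gt0.
move=> /(_ _ e0)[_ [n [c [g [gG ->]]]]].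
pose x : X := (true, (circle1 R, circle1 R)).
move=> gP; have := gP x; have := gP (fibre_rot circleN1 x).
have -> : \sum_(k < n) c k * g k (fibre_rot circleN1 x) = \sum_(k < n) c k * g k
  x.
  apply: eq_bigr => k _; have [m _ gm] := gG k.
  by rewrite (fibre_rotN1_quasi_eigen gm).
set s := \sum_(k < n) _ => h1 h2.
have : cabs (2 : C) <= 2^-1 + 2^-1.
  have -> : (2 : C) = (fibre_coord x - s) + (-1) * (fibre_coord (fibre_rot
    circleN1 x) - s).
    by rewrite /fibre_coord /=; ring.
  apply: le_trans (ler_cabsD _ _) _; apply: lerD => //.
  by rewrite cabsM {1}/cabs normrN normr1 mul1r.
have -> : cabs (2 : C) = 2.
  by apply: complexI; rewrite cabsE normr_nat rmorph_nat.
lra.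
Qed.

End NotQuasiDiscrete.

(** * Quasi-eigenfunctions of the enveloping semigroup *)

Section LinSpan.
Variables (R : realType) (T : Type).
Local Notation C := (C R).
Variable G : set (T -> C).
Hypothesis G1 : G (fun=> 1).
Hypothesis GM : forall g h, G g -> G h -> G (fun x => g x * h x).
Hypothesis GJ : forall g, G g -> G (fun x => ((g x)^*)%C).

Lemma lin_span_mem c g : G g -> lin_span G (fun x => c * g x).
Proof.
move=> Gg; exists 1%N, (fun=> c), (fun=> g); split => //.
by apply/funext => x; rewrite big_ord1.
Qed.

Lemma lin_span_add f g : lin_span G f -> lin_span G g ->
  lin_span G (fun x => f x + g x).
Proof.
move=> [n [c [u [uG ->]]]] [m [d [v [vG ->]]]].
exists (n + m)%N, (fun k => match fintype.split k with inl i => c i | inr j => d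
  j end),
  (fun k => match fintype.split k with inl i => u i | inr j => v j end); split.
  by move=> k; case: fintype.split.
apply/funext => x; rewrite big_split_ord /=; congr (_ + _);
  apply: eq_bigr => i _.
  by rewrite (unsplitK (inl i)).
by rewrite (unsplitK (inr i)).
Qed.

Lemma lin_span_sum n (f : 'I_n -> T -> C) : (forall k, lin_span G (f k)) ->
  lin_span G (fun x => \sum_(k < n) f k x).
Proof.
elim: n f => [|n IH] f fG.
  exists 0%N, (fun=> 0), (fun=> fun=> 1); split => //.
  by apply/funext => x; rewrite !big_ord0.
rewrite (_ : (fun _ => _) =
    (fun x => f ord0 x + \sum_(k < n) f (lift ord0 k) x)).
  by apply: lin_span_add => //; apply: IH.
by apply/funext => x; rewrite big_ord_recl.
Qed.

Lemma lin_span_mul f g : lin_span G f -> lin_span G g ->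
  lin_span G (fun x => f x * g x).
Proof.
move=> [n [c [u [uG ->]]]] [m [d [v [vG ->]]]].
rewrite (_ : (fun _ => _) = (fun x => \sum_(i < n) \sum_(j < m)
    (c i * d j) * (u i x * v j x))).
  apply: lin_span_sum => i; apply: lin_span_sum => j.
  exact: (lin_span_mem _ (GM (uG i) (vG j))).
apply/funext => x; rewrite mulr_suml; apply: eq_bigr => i _.
by rewrite mulr_sumr; apply: eq_bigr => j _; rewrite mulrACA.
Qed.

Lemma lin_span_conj f : lin_span G f -> lin_span G (fun x => ((f x)^*)%C).
Proof.
move=> [n [c [u [uG ->]]]].
rewrite (_ : (fun _ => _) = (fun x => \sum_(i < n) ((c i)^*)%C * ((u i
  x)^*)%C)).
  by apply: lin_span_sum => i; exact: (lin_span_mem _ (GJ (uG i))).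
apply/funext => x; rewrite (rmorph_sum (@conjc R)); apply: eq_bigr => i _.
exact: rmorphM.
Qed.

Lemma lin_span_cst c : lin_span G (fun=> c).
Proof.
by rewrite (_ : (fun=> c) = (fun x : T => c * 1)); [exact: lin_span_mem|
  apply/funext => x; rewrite mulr1].
Qed.

Lemma lin_span_sub g : G g -> lin_span G g.
Proof.
move=> Gg; rewrite (_ : g = (fun x : T => 1 * g x)); first exact: lin_span_mem.
by apply/funext => x; rewrite mul1r.
Qed.

End LinSpan.

Lemma lin_span_continuous (R : realType) (T : topologicalType) (G : set (T ->
  C R)) f :
  (forall g, G g -> continuous g) -> lin_span G f -> continuous f.
Proof.
move=> Gc [n [c [u [uG ->]]]]; elim: n c u uG => [|n IH] c u uG.
  rewrite (_ : (fun _ => _) = (fun=> 0)); first exact: cst_continuous_fun.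
  by apply/funext => x; rewrite big_ord0.
rewrite (_ : (fun _ => _) = (fun x => c ord0 * u ord0 x +
    \sum_(k < n) c (lift ord0 k) * u (lift ord0 k) x)).
  apply: add_continuous_fun (IH _ _ _); last by move=> k; exact: uG.
  exact: mul_continuous_fun (@cst_continuous_fun R T _) (Gc _ (uG _)).
by apply/funext => x; rewrite big_ord_recl.
Qed.

(** The quasi-eigenfunctions form a group, so their span is an algebra. Conjugation is inversion on
    circle-valued functions, so the span is self-adjoint and Stone-Weierstrass applies. *)
Lemma quasi_discrete_of_separating (R : realType) (X : dynSys) :
  (forall x y : X, x <> y -> exists2 g, quasi_eigenfunctions (X :=
    X) g & g x <> g y :> C R) ->
  quasi_discrete_spectrum R X.
Proof.
move=> sep f cf; apply/uniform_closureP => e e0.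
pose G : set (X -> C R) := @quasi_eigenfunctions R X.
have G1 : G (fun=> 1) by exists 0%N => //; exists 1 => //; rewrite normr1.
have Gc g : G g -> continuous g by move=> [m _ /quasi_eigen_circle[]].
have GM g h : G g -> G h -> G (fun x => g x * h x).
  move=> [m _ gm] [k _ hk]; exists (maxn m k) => //.
  by apply: quasi_eigenM; [apply: quasi_eigen_le gm; exact: leq_maxl|
    apply: quasi_eigen_le hk; exact: leq_maxr].
have GJ g : G g -> G (fun x => ((g x)^*)%C).
  move=> [m _ gm]; exists m => //.
  rewrite (_ : (fun _ => _) = (fun x => (g x)^-1)); first exact: quasi_eigenV.
  apply/funext => x; have [_ g1] := quasi_eigen_circle gm.
  by rewrite invc_norm g1 expr1n invr1 mul1r.
have Lsep x y : x <> y -> exists2 g, lin_span G g & g x <> g y.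
  by move=> /sep[g Gg gxy]; exists g => //; exact: lin_span_sub.
exact: (stone_weierstrass (@space_compact X) (fun g => lin_span_continuous Gc)
  (lin_span_cst G1) (@lin_span_add _ _ G) (lin_span_mul G1 GM)
  (lin_span_conj G1 GJ) Lsep cf e0).
Qed.

(** * The orbit of the identity in the enveloping semigroup *)

Section EnvelopingDense.
Variable X : dynSys.

Lemma ellis_id : ellis (@id X).
Proof. by apply: subset_closure; exists 0. Qed.

Definition enveloping_id : enveloping X := SigSub (mem_set ellis_id).

Lemma enveloping_orbit n :
  val (@shiftz (enveloping X) n enveloping_id) = @shiftz X n.
Proof.
case: n => n; elim: n => [|n IH] //; apply/funext => x.
  by rewrite /= -[X in _ = shift X]/(shiftz (Posz n) x) -IH.
by rewrite /= -[X in _ = shiftV X]/(shiftz (Negz n) x) -IH.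
Qed.

(** The orbit of the identity consists of the powers of the homeomorphism, which are dense in E(X)
    by definition. *)
Lemma enveloping_generated (N : set (enveloping X)) :
  closed N -> invariant_set N -> N enveloping_id -> N = setT.
Proof.
move=> cN NI Nid; apply/seteqP; split => // a _; apply: cN => B nB.
have [D [oD Da] DB] : exists2 D : set {ptws X -> X},
    open_nbhs (val a) D & set_val @^-1` D `<=` B.
  by move: nB; rewrite nbhsE => -[_ [[D oD <-] Da] DB]; exists D.
have [_ [[n _ <-] Dn]] := set_mem (valP a) _ (open_nbhs_nbhs (conj oD Da)).
exists (@shiftz (enveloping X) n enveloping_id); split.
  exact: invariant_shiftz.
by apply: DB; rewrite /= -[set_val _]/(val _) enveloping_orbit.
Qed.

End EnvelopingDense.

(** * Coordinates and quasi-eigenfunctions on E(X) *)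

Section EnvelopingX.
Variable R : realType.
Local Notation C := (C R).
Local Notation S1 := (circle R).
Local Notation X := (skew_sys R).
Local Notation Y := (enveloping X).

Lemma enveloping_eval_continuous (g : X -> C) (x : X) : continuous g ->
  continuous (fun a : Y => g (val a x)).
Proof.
move=> cg a; apply: (@continuous_comp Y {ptws X ->
  X} C set_val (fun f => g (f x))).
  exact: (@initial_continuous (@ellis X) {ptws X -> X} set_val a).
exact: eval_continuous.
Qed.

(** Members of E(X) commute with fibre rotations and with the step, so their values at these points
    determine them. *)
Definition base_pt (z : S1) : X := (false, (z, circle1 R)).

Definition parity (a : Y) : C := comp_sgn (val a (base_pt (circle1 R))).
Definition base_char (a : Y) : C := base_coord (val a (base_pt (circle1 R))).
Definition fibre_char (z : S1) (a : Y) : C := fibre_coord (val a (base_pt z)).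
Definition in_odd (a : Y) : bool := (val a (base_pt (circle1 R))).1.

Lemma comp_base_pt (a : Y) z : (val a (base_pt z)).1 = in_odd a.
Proof.
have := ellis_comp_sgn (base_pt z) (base_pt (circle1 R)) (set_mem (valP a)).
rewrite {2}/comp_sgn {3}/comp_sgn /= !mulr1 => /comp_sgn_inj.
exact.
Qed.

Lemma base_coord_pt (a : Y) z :
  base_coord (val a (base_pt z)) = val z * base_char a.
Proof.
have := ellis_base_coord (base_pt z) (base_pt (circle1 R)) (set_mem (valP a)).
by rewrite /base_coord /base /= mulr1 mulrC.
Qed.

Lemma base_char_shift a : base_char (shift a) = val (beta R) * base_char a.
Proof. by []. Qed.

Lemma in_odd_shift a : in_odd (shift a) = ~~ in_odd a.
Proof. by []. Qed.

Lemma fibre_char_shift z a :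
  fibre_char z (shift a) =
  if in_odd a then fibre_char z a else val z * base_char a * fibre_char z a.
Proof.
have wS (x : X) : fibre_coord (shift x) = if x.1 then fibre_coord x else
  base_coord x * fibre_coord x.
  by case: x => -[].
by rewrite -base_coord_pt -(comp_base_pt a z); exact: wS.
Qed.

(** At s^n the quotient is the power of r^2 with exponent ceil(n/2), that is r^n for even n and
    r^(n+1) for odd n; the last factor removes the excess. *)
Definition root_char (r : S1) (a : Y) : C :=
  fibre_char (circleM r r) a / fibre_char (circle1 R) a * (if in_odd a then (val
    r)^-1 else 1).

Lemma norm_fibre_char z a : `|fibre_char z a| = 1.
Proof. exact: norm_val. Qed.

Lemma fibre_char_neq0 z a : fibre_char z a != 0.
Proof. exact: val_neq0. Qed.

Lemma base_char_neq0 a : base_char a != 0.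
Proof. exact: val_neq0. Qed.

Lemma root_char_shift r a : root_char r (shift a) = val r * root_char r a.
Proof.
rewrite /root_char !fibre_char_shift in_odd_shift; have r0 := val_neq0 r.
have := fibre_char_neq0 (circle1 R) a; have := base_char_neq0 a.
case: (in_odd a) => /= z0 w0; first by field; rewrite r0 w0.
by field; rewrite r0 w0 z0.
Qed.

Lemma fibre_char_continuous z : continuous (fibre_char z).
Proof. exact: enveloping_eval_continuous (@fibre_coord_continuous R). Qed.

Lemma in_odd_continuous (u v : C) : continuous (fun a => if in_odd a then u else
  v).
Proof.
apply: (@enveloping_eval_continuous (fun x : X => if x.1 then u else v)).
by apply: slice_continuous => b; exact: cst_continuous_fun.
Qed.

Lemma root_char_continuous r : continuous (root_char r).
Proof.
apply: (@mul_continuous_fun R Y (fun a => fibre_char (circleM r r) a /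
  fibre_char (circle1 R) a)).
  apply: (mul_continuous_fun (@fibre_char_continuous _)).
  exact: (inv_continuous_fun (@fibre_char_continuous _) (@fibre_char_neq0 _)).
exact: in_odd_continuous.
Qed.

Lemma norm_root_char r a : `|root_char r a| = 1.
Proof.
rewrite /root_char !normrM normfV !norm_fibre_char invr1 !mul1r.
by case: ifP => _; rewrite ?normfV ?norm_val ?invr1 ?normr1.
Qed.

Lemma eigenfunction_quasi (g : Y -> C) (l : C) : `|l| = 1 -> circle_valued g ->
  (forall a, g (shift a) = l * g a) -> quasi_eigen 1 g.
Proof.
by move=> l1 gc gl; split => //; exists (fun=> l); [exists l|exact/funext].
Qed.

Lemma root_char_quasi r : quasi_eigen 1 (root_char r).
Proof.
apply: (@eigenfunction_quasi _ (val r)); first exact: norm_val.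
  by split; [exact: root_char_continuous|exact: norm_root_char].
exact: root_char_shift.
Qed.

Lemma base_char_continuous : continuous base_char.
Proof. exact: enveloping_eval_continuous (@base_coord_continuous R). Qed.

Lemma base_char_quasi : quasi_eigen 1 base_char.
Proof.
apply: (@eigenfunction_quasi _ (val (beta R))); first exact: norm_val.
  by split; [exact: base_char_continuous|move=> a; exact: norm_val].
exact: base_char_shift.
Qed.

Lemma parity_quasi : quasi_eigen 1 parity.
Proof.
apply: (@eigenfunction_quasi _ (-1)); first by rewrite normrN normr1.
  split; first exact: enveloping_eval_continuous (@comp_sgn_continuous R).
  by move=> a; rewrite /parity /comp_sgn; case: ifP => _;
    rewrite ?normrN normr1.
have sS (x : X) : comp_sgn (shift x) = -1 * comp_sgn x.
  by case: x => -[] [? ?]; rewrite /comp_sgn /= mulN1r ?opprK.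
by move=> a; exact: sS.
Qed.

(** Both sides are eigenfunctions with eigenvalue beta and value 1 at the identity. The set where
    they agree is closed and invariant, hence all of E(X). *)
Lemma root_char_sqr (r : S1) a : val r * val r = val (beta R) ->
  root_char r a * root_char r a = base_char a.
Proof.
move=> rb; have r0 := val_neq0 r.
suff : [set a | root_char r a * root_char r a = base_char a] = setT by
  move/seteqP => -[_ /(_ a I)].
apply: enveloping_generated.
- apply: (closed_eq_fun (f := fun a => root_char r a * root_char r a));
  last exact: base_char_continuous.
  exact: mul_continuous_fun (@root_char_continuous r) (@root_char_continuous r).
- have E b : root_char r (shift b) * root_char r (shift b) = val (beta R) *
  (root_char r b * root_char r b).
    by rewrite root_char_shift -rb; ring.
  split => b /= Eb; first by rewrite E base_char_shift Eb.
  apply: (mulfI (val_neq0 (beta R))); rewrite -E -base_char_shift shiftVK.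
  exact: Eb.
- rewrite /= /root_char /fibre_char /base_char /in_odd /= /fibre_coord
  /base_coord /fibre /base /=.
  by rewrite !divr1 !mulr1.
Qed.

(* For beta = e(b), rho = e(b/2) and kappa = e(b/4) this is n |-> e(n^2 b/4)
   along the orbit of the identity. *)
Definition quadratic_char (rho kappa : S1) (a : Y) : C :=
  fibre_char (circle1 R) a * (if in_odd a then val kappa else root_char rho a).

Lemma quadratic_char_quasi rho kappa : val rho * val rho = val (beta R) ->
  val kappa * val kappa = val rho -> quasi_eigen 2 (quadratic_char rho kappa).
Proof.
move=> rb kr; split.
  split; last first.
    move=> a; rewrite /quadratic_char normrM norm_fibre_char mul1r.
    by case: ifP => _; rewrite ?norm_val ?norm_root_char.
  rewrite (_ : quadratic_char rho kappa = fun a => fibre_char (circle1 R) a *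
    ((if in_odd a then val kappa else 0) + (if in_odd a then 0 else 1) *
      root_char rho a)).
    apply: (mul_continuous_fun (@fibre_char_continuous _)).
    apply: (add_continuous_fun (@in_odd_continuous _ _)).
    exact: (mul_continuous_fun (@in_odd_continuous _ _) (@root_char_continuous
      _)).
  by apply/funext => a; rewrite /quadratic_char; case: ifP => _;
    rewrite ?mul0r ?mul1r ?addr0 ?add0r.
(* As (n+1)^2 - n^2 = 2n + 1, the successive quotient is e(b/4) e(nb/2), that is kappa rho^n. *)
exists (fun a => val kappa * root_char rho a).
  apply: (@quasi_eigenM R Y 1 (fun=> val kappa)); last exact: root_char_quasi.
  by apply: quasi_eigenS; exists (val kappa) => //; exact: norm_val.
apply/funext => a /=; rewrite /quadratic_char fibre_char_shift in_odd_shift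
  root_char_shift.
case: (in_odd a) => /=.
  rewrite -[sval rho]/(val rho) -kr -[sval kappa]/(val kappa).
  by move: (fibre_char _ a) (root_char rho a) (val kappa) => w e k; ring.
rewrite mul1r -(root_char_sqr a rb) -[sval kappa]/(val kappa).
by move: (fibre_char _ a) (root_char rho a) (val kappa) => w e k; ring.
Qed.

(** The quadratic character recovers [fibre_char] at 1, and the characters [root_char r] then
    recover it at every z = r^2. With the parity and the base character this fixes the values at all
    [base_pt z]; commutation with fibre rotations and with the step gives the rest. *)
Lemma quasi_eigen_separating (a b : Y) :
  (forall g : Y -> C, quasi_eigenfunctions g -> g a = g b) -> a = b.
Proof.
move=> gab.
(* [circle_root] with index 1 returns square roots. *)
have [rho rr] := circle_root (beta R) 1.
have [kappa kk] := circle_root rho 1.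
have q m (g : Y -> C) : quasi_eigen m g -> g a = g b.
  by move=> gm; apply: gab; exists m.
have parab := q _ _ parity_quasi; have zetab := q _ _ base_char_quasi.
have eigab r := q _ _ (root_char_quasi r).
have quadab := q _ _ (quadratic_char_quasi rr kk).
have oddab : in_odd a = in_odd b.
  exact: comp_sgn_inj parab.
have wet1 : fibre_char (circle1 R) a = fibre_char (circle1 R) b.
  move: quadab; rewrite /quadratic_char oddab (eigab rho); apply: mulIf.
  by case: ifP => _; [exact: val_neq0|rewrite -normr_eq0 norm_root_char
    oner_eq0].
have wetz z : fibre_char z a = fibre_char z b.
  have [r rz] := circle_root z 1.
  have <- : circleM r r = z by apply: val_inj.
  have := eigab r; rewrite /root_char oddab wet1 => E.
  apply: (mulIf (x := (fibre_char (circle1 R) b)^-1));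
    first by rewrite invr_eq0 fibre_char_neq0.
  apply: mulIf E; case: ifP => _; last exact: oner_neq0.
  by rewrite invr_eq0 val_neq0.
have ptab z : val a (base_pt z) = val b (base_pt z).
  apply: coord_inj; last exact: wetz.
    by rewrite /comp_sgn !comp_base_pt oddab.
  by rewrite !base_coord_pt zetab.
have comm (S : X -> X) c x : continuous S -> (forall x, S (shift x) = shift (S
  x)) ->
    val (c : Y) (S x) = S (val c x).
  by move=> cS ST; apply: ellis_commute => //; exact: (set_mem (valP c)).
have evab z w : val a (false, (z, w)) = val b (false, (z, w)).
  have -> : (false, (z, w)) = fibre_rot w (base_pt z).
    by rewrite /fibre_rot /base_pt /= circleMC circle1M.
  by rewrite !(comm (fibre_rot w)) ?ptab //; (exact: fibre_rot_continuous ||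
    exact: fibre_rot_step).
apply: val_inj; apply/funext => -[[] [z w]]; last exact: evab.
(* Points of the component [true] are images under the step of points of [false]. *)
rewrite -(shiftVK ((true, (z, w)) : X)) !(comm (@shift X)) //;
  try exact: shift_continuous.
by rewrite [shiftV _]/(skew_stepV _) /skew_stepV /= evab.
Qed.

Theorem enveloping_skew_sys_quasi_discrete : quasi_discrete_spectrum R Y.
Proof.
apply: quasi_discrete_of_separating => a b ab; apply: contrapT => nex;
  apply: ab.
apply: quasi_eigen_separating => g Gg; apply: contrapT => gab.
by apply: nex; exists g.
Qed.

End EnvelopingX.

Theorem mainTheorem10 (R : realType) :
  exists X : dynSys,
    [/\ minimal_sys X, distal_sys X,
        quasi_discrete_spectrum R (enveloping X)
      & ~ quasi_discrete_spectrum R X].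
Proof.
exists (skew_sys R); split.
- exact: skew_sys_minimal.
- exact: skew_sys_distal.
- exact: enveloping_skew_sys_quasi_discrete.
- exact: skew_sys_not_quasi_discrete.
Qed.
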